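(* Let $\alpha \leq \omega_1^{ck}$ be a limit ordinal and let $Z \subseteq \omega$ be such that $Z$ is not $\emptyset^{(\beta)}$-computable for every $\beta < \alpha$. Then for every set $A \subseteq \omega$ there is an infinite set $G$ with $G\subseteq A$ or $G \subseteq \omega\setminus A$ such that for every $\beta < \alpha$, $Z$ is not $G^{(\beta)}$-computable.
   Context: Ordinals $\beta<\omega_1^{ck}$ are handled via a fixed system of unique notations. The iterated jumps are defined by $X^{(0)}=X$, $X^{(\beta+1)}=(X^{(\beta)})'$, and $X^{(\lambda)}=\bigoplus_n X^{(\lambda_n)}$ for a limit $\lambda = \sup_n \lambda_n$ given by its notation. *)

(* Defs.v *)
From HB Require Import structures.
From mathcomp Require Import all_boot.
Set Implicit Arguments. Unset Strict Implicit. Unset Printing Implicit Defensive.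

Definition set_nat := nat -> bool.

Definition cpair (a b : nat) : nat := ((a + b) * (a + b).+1)./2 + b.

(* Unary oracle mu-recursive programs (a Turing-complete basis using pairing). *)
Inductive prog : Type :=
| PZero
| PSucc
| PId
| PFst
| PSnd
| POracle
| PComp of prog & prog
| PPair of prog & prog
| PRec of prog & prog
| PMu of prog.

Fixpoint prog_enc (p : prog) : GenTree.tree nat :=
  match p with
  | PZero => GenTree.Node 0 [::]
  | PSucc => GenTree.Node 1 [::]
  | PId => GenTree.Node 2 [::]
  | PFst => GenTree.Node 3 [::]
  | PSnd => GenTree.Node 4 [::]
  | POracle => GenTree.Node 5 [::]
  | PComp f g => GenTree.Node 6 [:: prog_enc f; prog_enc g]
  | PPair f g => GenTree.Node 7 [:: prog_enc f; prog_enc g]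
  | PRec f g => GenTree.Node 8 [:: prog_enc f; prog_enc g]
  | PMu f => GenTree.Node 9 [:: prog_enc f]
  end.

Fixpoint prog_dec (t : GenTree.tree nat) : option prog :=
  match t with
  | GenTree.Node 0 [::] => Some PZero
  | GenTree.Node 1 [::] => Some PSucc
  | GenTree.Node 2 [::] => Some PId
  | GenTree.Node 3 [::] => Some PFst
  | GenTree.Node 4 [::] => Some PSnd
  | GenTree.Node 5 [::] => Some POracle
  | GenTree.Node 6 [:: tf; tg] =>
      if prog_dec tf is Some f then if prog_dec tg is Some g then Some (PComp f g) else None else None
  | GenTree.Node 7 [:: tf; tg] =>
      if prog_dec tf is Some f then if prog_dec tg is Some g then Some (PPair f g) else None else None
  | GenTree.Node 8 [:: tf; tg] =>
      if prog_dec tf is Some f then if prog_dec tg is Some g then Some (PRec f g) else None else None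
  | GenTree.Node 9 [:: tf] =>
      if prog_dec tf is Some f then Some (PMu f) else None
  | _ => None
  end.

Lemma prog_encK : pcancel prog_enc prog_dec.
Proof. by elim=> //= f -> // g ->. Qed.

HB.instance Definition _ := Countable.copy prog (pcan_type prog_encK).

Definition prog_of (e : nat) : option prog := unpickle e.

Inductive eval (X : set_nat) : prog -> nat -> nat -> Prop :=
| ev_zero x : eval X PZero x 0
| ev_succ x : eval X PSucc x x.+1
| ev_id x : eval X PId x x
| ev_fst a b : eval X PFst (cpair a b) a
| ev_snd a b : eval X PSnd (cpair a b) b
| ev_oracle x : eval X POracle x (nat_of_bool (X x))
| ev_comp f g x y z : eval X g x y -> eval X f y z -> eval X (PComp f g) x z
| ev_pair f g x y z : eval X f x y -> eval X g x z -> eval X (PPair f g) x (cpair y z)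
| ev_rec0 f g y v : eval X f y v -> eval X (PRec f g) (cpair 0 y) v
| ev_recS f g n y u v :
    eval X (PRec f g) (cpair n y) u -> eval X g (cpair n (cpair u y)) v ->
    eval X (PRec f g) (cpair n.+1 y) v
| ev_mu f x n : search X f x 0 n -> eval X (PMu f) x n
with search (X : set_nat) : prog -> nat -> nat -> nat -> Prop :=
| se_found f x i : eval X f (cpair i x) 0 -> search X f x i i
| se_next f x i k n : eval X f (cpair i x) k.+1 -> search X f x i.+1 n -> search X f x i n.

Definition phi (X : set_nat) (e x v : nat) : Prop :=
  exists2 p, prog_of e = Some p & eval X p x v.

Definition empty_set : set_nat := fun _ => false.

Definition Tred (Z X : set_nat) : Prop :=
  exists p : prog, forall x, eval X p x (nat_of_bool (Z x)).

Definition is_jump (X J : set_nat) : Prop :=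
  forall e, J e = true <-> exists v, phi X e e v.

(* Kleene's O and <_O (notations: 1 for 0, 2^a for successors,
   3*5^e for limits of the <_O-increasing total computable sequence phi_e). *)
Inductive inO : nat -> Prop :=
| O_zero : inO 1
| O_succ a : inO a -> inO (2 ^ a)
| O_lim e (f : nat -> nat) :
    (forall n, phi empty_set e n (f n)) -> (forall n, ltO (f n) (f n.+1)) ->
    inO (3 * 5 ^ e)
with ltO : nat -> nat -> Prop :=
| ltO_succ a : inO a -> ltO a (2 ^ a)
| ltO_lim e n a : inO (3 * 5 ^ e) -> phi empty_set e n a -> ltO a (3 * 5 ^ e)
| ltO_trans a b c : ltO a b -> ltO b c -> ltO a c.

Inductive IJ (X : set_nat) : nat -> set_nat -> Prop :=
| IJ_zero Y : (forall n, Y n = X n) -> IJ X 1 Y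
| IJ_succ a Z Y : IJ X a Z -> is_jump Z Y -> IJ X (2 ^ a) Y
| IJ_lim e (f : nat -> nat) (Zs : nat -> set_nat) Y :
    (forall n, phi empty_set e n (f n)) ->
    (forall n, IJ X (f n) (Zs n)) ->
    (forall n m, Y (cpair n m) = Zs n m) ->
    IJ X (3 * 5 ^ e) Y.

Definition Tred_jump (Z X : set_nat) (b : nat) : Prop :=
  exists2 Y, IJ X b Y & Tred Z Y.

Definition ord_le (a b : nat) : Prop :=
  exists g : nat -> nat,
    (forall c, ltO c a -> ltO (g c) b) /\
    (forall c d, ltO c a -> ltO d a -> ltO c d -> ltO (g c) (g d)).

(* A system of unique notations for all ordinals < omega_1^ck:
   a path through O (downward closed, linearly ordered by <_O) that is full
   (reaches every ordinal that has a notation in O). *)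
Definition notation_system (P : nat -> Prop) : Prop :=
  [/\ (forall b, P b -> inO b),
      (forall a b, P b -> ltO a b -> P a),
      (forall a b, P a -> P b -> [\/ a = b, ltO a b | ltO b a]) &
      (forall a, inO a -> exists2 b, P b & ord_le a b)].

(* A limit ordinal alpha <= omega_1^ck relative to P:
   None = omega_1^ck, Some a = the ordinal with limit notation a in P. *)
Definition limit_ord (P : nat -> Prop) (alpha : option nat) : Prop :=
  match alpha with
  | None => True
  | Some a => P a /\ exists e, a = 3 * 5 ^ e
  end.

Definition below (P : nat -> Prop) (alpha : option nat) (b : nat) : Prop :=
  P b /\ match alpha with None => True | Some a => ltO b a end.

Definition infinite_set (G : set_nat) : Prop := forall n, exists2 m, n <= m & G m.
Definition subset_of (G A : set_nat) : Prop := forall x, G x -> A x.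
Definition compl (A : set_nat) : set_nat := fun x => ~~ A x.

(* Main.v *)
Require Import Defs.
From mathcomp Require Import all_boot zify.
From mathcomp Require Import boolp.
Set Implicit Arguments. Unset Strict Implicit. Unset Printing Implicit Defensive.

(** Call an upward closed open class [U] of sets large if every finite colouring
of the integers has a colour class in [U]; by compactness this is arithmetical in
an enumeration of a base of [U].  By recursion on the notation [b] one builds
(i) a relation answering, for a finite string [E], literals about membership in
[G^(b)], and (ii) a family of open classes with large finite intersections.  At a
successor, to [(E, k)] corresponds the class of all [Y] such that some extension
of [E] by elements of [Y] makes [k] enter the next jump according to the answers
already given; these classes are accepted greedily as long as the family stays
large, and [E] answers "no" to [k] when the class of [(E, k)] is rejected.

The sets such that, for every finite colouring and all finitely many accepted
classes, some colour restricted to the set lies in these classes form a partition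
regular collection which contains the set of all integers, hence [A] or its
complement.  Inside a set of the collection one
forces with pairs (string, reservoir in the collection): if the class of [(E, k)]
is accepted, the reservoir meets it, so a positive answer can be forced; if it is
rejected, a colouring witnesses this and one colour shrinks the reservoir to a set
outside the class, forcing a negative answer.  If a generic [G] computed [Z] from
[G^(b)], then [Z] would be computable from the answers at level [b + 1].

These answers are computable from [0^(b+n)] for some finite [n], and [b + n] stays
below the limit ordinal [alpha].  At a limit notation uniformity is obtained by
verification instead of effective transfinite recursion: a sequence of levels is
characterized by local arithmetical conditions, so among all sets enumerable from
the oracle one can recognize arithmetically those that code such sequences. *)

(** * The pairing bijection and its inverse *)

Arguments cpair : simpl never.

(** Walks along the antidiagonals in the order of [cpair]: from [(a.+1, b)] to [(a, b.+1)], and from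
    the end [(0, b)] of one to the start [(b.+1, 0)] of the next. *)
Fixpoint cun (n : nat) : nat * nat :=
  if n is m.+1 then
    (if (cun m).1 is a.+1 then (a, (cun m).2.+1) else ((cun m).2.+1, 0))
  else (0, 0).
Lemma cunS m : cun m.+1 =
  if (cun m).1 is a.+1 then (a, (cun m).2.+1) else ((cun m).2.+1, 0).
Proof. by []. Qed.

Definition cfst n := (cun n).1.
Definition csnd n := (cun n).2.

Lemma tri_succ s : (s.+1 * s.+2)./2 = (s * s.+1)./2 + s.+1.
Proof.
have -> : s.+1 * s.+2 = s * s.+1 + s.+1.*2 by rewrite -mul2n; nia.
by rewrite halfD odd_double andbF doubleK.
Qed.

Lemma cpair_0S b : cpair b.+1 0 = (cpair 0 b).+1.
Proof. rewrite /cpair add0n !addn0 tri_succ; lia. Qed.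

Lemma cpair_SS a b : cpair a b.+1 = (cpair a.+1 b).+1.
Proof. by rewrite /cpair addnS addSn addnS. Qed.

Lemma cunK n : cpair (cfst n) (csnd n) = n.
Proof.
elim: n => // n; rewrite /cfst /csnd /=.
case: (cun n) => [[|a] b] /= IH; first by rewrite cpair_0S IH.
by rewrite cpair_SS IH.
Qed.

Lemma cpairK a b : cun (cpair a b) = (a, b).
Proof.
have [n le] := ubnP (cpair a b); elim: n a b le => // n IH a [|b] le.
  case: a le => [|a] le //; rewrite cpair_0S in le; rewrite cpair_0S cunS IH //.
rewrite cpair_SS in le; rewrite cpair_SS cunS IH //.
Qed.

Lemma cfstK a b : cfst (cpair a b) = a. Proof. by rewrite /cfst cpairK. Qed.
Lemma csndK a b : csnd (cpair a b) = b. Proof. by rewrite /csnd cpairK. Qed.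

Lemma cpair_inj a b c d : cpair a b = cpair c d -> a = c /\ b = d.
Proof. by move=> e; have := cpairK a b; rewrite e cpairK => -[-> ->]. Qed.

Lemma leq_cpairr a b : b <= cpair a b.
Proof. by rewrite /cpair leq_addl. Qed.

(* Determinism of evaluation *)
Scheme eval_mind := Induction for eval Sort Prop
  with search_mind := Induction for search Sort Prop.
Combined Scheme eval_search_ind from eval_mind, search_mind.

(** [cpair] is a function and not a constructor, so inversion leaves equations between codes, which
    injectivity has to resolve. *)
Ltac inv H := inversion H; clear H; subst;
  repeat match goal with
  | E : cpair _ _ = cpair _ _ |- _ =>
      let E1 := fresh in let E2 := fresh in
      case: (cpair_inj E) => E1 E2; clear E; first [discriminate E1 | idtac];
      try (injection E1; clear E1; intro E1); subst
  end.

Lemma eval_recS_inv X f g z v : eval X (PRec f g) z v ->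
  forall n y, z = cpair n.+1 y ->
  exists2 u, eval X (PRec f g) (cpair n y) u & eval X g (cpair n (cpair u y)) v.
Proof.
move=> H n y; inversion H; subst => /cpair_inj[] // -[? ?]; subst.
by exists u.
Qed.

Lemma eval_comp_inv X f g z v : eval X (PComp f g) z v ->
  exists2 u, eval X g z u & eval X f u v.
Proof. by move=> H; inversion H; subst; exists y. Qed.

Lemma eval_search_det X :
  (forall p x v, eval X p x v -> forall w, eval X p x w -> v = w) /\
  (forall p x i n, search X p x i n -> forall m, search X p x i m -> n = m).
Proof.
apply: (@eval_search_ind X (fun p x v _ => forall w, eval X p x w -> v = w)
  (fun p x i n _ => forall m, search X p x i m -> n = m)).
- by move=> x w H; inv H.
- by move=> x w H; inv H.
- by move=> x w H; inv H.
- by move=> a b w H; inv H.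
- by move=> a b w H; inv H.
- by move=> x w H; inv H.
- move=> f g x y z _ IHg _ IHf w H; inv H.
  by match goal with E : eval X g x _ |- _ => have ? := IHg _ E end; subst; apply: IHf.
- move=> f g x y z _ IHf _ IHg w H; inv H; congr cpair; by [apply: IHf | apply: IHg].
- by move=> f g y v _ IH w H; inv H; apply: IH.
- move=> f g n y u v _ IH1 _ IH2 w H.
  have [u' /IH1 <- H2] := eval_recS_inv H (erefl _); exact: IH2.
- by move=> f x n _ IH w H; inv H; apply: IH.
- move=> f x i _ IH m H; inv H => //.
  by match goal with E : eval X f _ _ |- _ => have := IH _ E end.
- move=> f x i k n _ IH1 _ IH2 m H; inv H; last by apply: IH2.
  by match goal with E : eval X f _ _ |- _ => have := IH1 _ E end.
Qed.

Lemma eval_det X p x v w : eval X p x v -> eval X p x w -> v = w.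
Proof. by move=> H; apply: (eval_search_det X).1 H _. Qed.

Lemma phi_det X e x v w : phi X e x v -> phi X e x w -> v = w.
Proof. by move=> [p E H] [q E']; move: E'; rewrite E => -[<-]; exact: eval_det. Qed.

(** * Computable functions *)

(** One program serves all oracles: reductions between questions must be fixed before the oracle,
    such as a jump of a generic set, is known. *)
Definition computable (f : nat -> nat) := exists p, forall X x, eval X p x (f x).

Lemma ev_fst' X x : eval X PFst x (cfst x).
Proof. rewrite -{1}(cunK x); exact: ev_fst. Qed.
Lemma ev_snd' X x : eval X PSnd x (csnd x).
Proof. rewrite -{1}(cunK x); exact: ev_snd. Qed.

Lemma computable_comp g f : computable g -> computable f -> computable (fun z => g (f z)).
Proof. by move=> [q Hq] [p Hp]; exists (PComp q p) => X x; exact: ev_comp. Qed.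

Lemma computable_id : computable (fun z => z).
Proof. exists PId => X x; exact: ev_id. Qed.

Lemma computable_succ f : computable f -> computable (fun z => (f z).+1).
Proof. by apply: computable_comp; exists PSucc => X x; exact: ev_succ. Qed.

Fixpoint pconst n := if n is m.+1 then PComp PSucc (pconst m) else PZero.

Lemma eval_const X n x : eval X (pconst n) x n.
Proof. elim: n => [|n IH] /=; [exact: ev_zero | exact: ev_comp IH (ev_succ _ _)]. Qed.

Lemma computable_const n : computable (fun _ => n).
Proof. exists (pconst n) => X x; exact: eval_const. Qed.

Lemma computable_fst f : computable f -> computable (fun z => cfst (f z)).
Proof. by apply: computable_comp; exists PFst => X x; exact: ev_fst'. Qed.

Lemma computable_snd f : computable f -> computable (fun z => csnd (f z)).
Proof. by apply: computable_comp; exists PSnd => X x; exact: ev_snd'. Qed.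

Lemma computable_pair f g : computable f -> computable g -> computable (fun z => cpair (f z) (g z)).
Proof. by move=> [p Hp] [q Hq]; exists (PPair p q) => X x; exact: ev_pair. Qed.

Lemma computable_iter F n g : computable F -> computable n -> computable g -> computable (fun z => iter (n z) F (g z)).
Proof.
move=> [p Hp] cn cg.
have H : computable (fun z => iter (cfst z) F (csnd z)).
  exists (PRec PId (PComp p (PComp PFst PSnd))) => X x.
  rewrite -{1}(cunK x); elim: (cfst x) => [|m IH] /=.
    by apply: ev_rec0; exact: ev_id.
  apply: ev_recS; first exact: IH.
  apply: ev_comp (Hp _ _); apply: ev_comp (ev_snd _ _ _) _; exact: ev_fst.
have := computable_comp H (computable_pair cn cg).
by congr computable; apply/funext => z; rewrite cfstK csndK.
Qed.

Lemma computable_if b f g : computable b -> computable f -> computable g ->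
  computable (fun z => if b z is _.+1 then f z else g z).
Proof.
move=> [pb Hb] [pf Hset] [pg Hg].
exists (PComp (PRec pg (PComp pf (PComp PSnd PSnd))) (PPair pb PId)) => X x.
apply: (ev_comp (ev_pair (Hb X x) (ev_id X x))).
elim: (b x) => [|m IH]; first exact: ev_rec0.
apply: ev_recS IH _; apply: ev_comp (Hset _ _).
by apply: ev_comp (ev_snd _ _ _) _; exact: ev_snd.
Qed.

Lemma computable_pred f : computable f -> computable (fun z => (f z).-1).
Proof.
apply: computable_comp; exists (PComp (PRec PZero PFst) (PPair PId PZero)) => X x.
apply: (ev_comp (ev_pair (ev_id X x) (ev_zero X x))).
case: x => [|m]; first by apply: ev_rec0; exact: ev_zero.
(* The step program [PFst] discards the previous value, but [ev_recS] still asks that there be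
   one. *)
have H : exists u, eval X (PRec PZero PFst) (cpair m 0) u.
  elim: m => [|m [u IH]]; first by exists 0; apply: ev_rec0; exact: ev_zero.
  by exists m; apply: ev_recS IH _; exact: ev_fst.
by case: H => u H; apply: ev_recS H _; exact: ev_fst.
Qed.

Lemma computable_add f g : computable f -> computable g -> computable (fun z => f z + g z).
Proof.
move=> cf1 cg; have := computable_iter (computable_succ computable_id) cf1 cg.
by congr computable; apply/funext => z; rewrite iter_succn addnC.
Qed.

Lemma computable_sub f g : computable f -> computable g -> computable (fun z => f z - g z).
Proof.
move=> cf1 cg; have := computable_iter (computable_pred computable_id) cg cf1.
by congr computable; apply/funext => z; rewrite iter_predn.
Qed.

Lemma computable_mulc n f : computable f -> computable (fun z => n * f z).
Proof.
move=> cff; elim: n => [|n IH]; first exact: computable_const.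
by have := computable_add cff IH; congr computable; apply/funext => z; rewrite mulSn.
Qed.

Lemma computable_expc_mul c f g : computable f -> computable g -> computable (fun z => c ^ f z * g z).
Proof.
move=> cf1 cg; have := computable_iter (computable_mulc c computable_id) cf1 cg.
congr computable; apply/funext => z; elim: (f z) => [|n IH] /=; first by rewrite mul1n.
by rewrite IH expnS mulnA.
Qed.

Lemma computable_bool (b : nat -> bool) f g :
  computable (fun z => b z) -> computable f -> computable g -> computable (fun z => if b z then f z else g z).
Proof.
by move=> cb c1 c2; have := computable_if cb c1 c2; congr computable; apply/funext => z; case: (b z).
Qed.

Lemma computable_leq f g : computable f -> computable g -> computable (fun z => (f z <= g z : bool)).
Proof.
move=> c1 c2; have := computable_if (computable_sub c1 c2) (computable_const 0) (computable_const 1).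
by congr computable; apply/funext => z; rewrite /leq; case: (_ - _).
Qed.

Lemma computable_eq f g : computable f -> computable g -> computable (fun z => (f z == g z : bool)).
Proof.
move=> c1 c2; have := computable_bool (computable_leq c1 c2) (computable_leq c2 c1) (computable_const 0).
by congr computable; apply/funext => z; rewrite eqn_leq; case: (_ <= _).
Qed.

(** * The jump *)

Definition tjump (X : set_nat) : set_nat := fun e => `[< exists v, phi X e e v >].

Lemma tj_is_jump X : is_jump X (tjump X).
Proof. by move=> e; split=> [/asboolP|/asboolP]. Qed.

(** The numeric cons of [CodeSeq.code]: the index of a program is a fold of [stp] over its
    symbols. *)
Definition stp (n m : nat) := 2 ^ n * m.*2.+1.
Lemma computable_stp f g : computable f -> computable g -> computable (fun z => stp (f z) (g z)).
Proof.
move=> c1 c2; apply: computable_expc_mul => //; apply: computable_succ.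
by have := computable_mulc 2 c2; congr computable; apply/funext => z; rewrite mul2n.
Qed.

Lemma computable_foldr_stp s f : computable f -> computable (fun z => foldr stp (f z) s).
Proof. by move=> c; elim: s => //= a s IH; apply: computable_stp => //; exact: computable_const. Qed.

(* The symbol coding is kept abstract: the actual numbers are huge. *)
Definition syms (sy : nat + nat -> nat) (p : prog) :=
  map sy (GenTree.encode (prog_enc p)).

Lemma syms_comp sy f g : syms sy (PComp f g) =
  sy (inl 7) :: syms sy f ++ syms sy g ++ [:: sy (inl 0)].
Proof. by rewrite /syms /= map_rcons !map_cat /= cats0 -cats1 -catA. Qed.

(** The program for the constant [x] nests [x] compositions with [PSucc]: opening symbols pile up on
    the left and closing ones on the right, so two iterations of length [x] build its code. *)
Lemma syms_const_cat sy x t : foldr stp t (syms sy (pconst x)) =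
  iter x (fun m => foldr stp m (sy (inl 7) :: syms sy PSucc))
    (foldr stp (iter x (stp (sy (inl 0))) t) (syms sy PZero)).
Proof.
elim: x t => [|x IH] t //.
rewrite [pconst _]/= syms_comp [iter x.+1 _ (foldr _ _ _)]iterS [iter x.+1 _ _]iterSr.
by rewrite -IH -cat1s !foldr_cat.
Qed.

Lemma computable_syms_comp_const sy q :
  computable (fun x => foldr stp 0 (syms sy (PComp q (pconst x)))).
Proof.
have C : computable (fun x => foldr stp (foldr stp
    (iter x (fun m => foldr stp m (sy (inl 7) :: syms sy PSucc))
    (foldr stp (iter x (stp (sy (inl 0))) (foldr stp 0 [:: sy (inl 0)]))
       (syms sy PZero))) (syms sy q)) [:: sy (inl 7)]).
  do 2!apply: computable_foldr_stp; apply: computable_iter; last 1 first.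
  - apply: computable_foldr_stp; apply: computable_iter; [|exact: computable_id|exact: computable_const].
    by apply: computable_stp; [exact: computable_const | exact: computable_id].
  - by apply: computable_foldr_stp; exact: computable_id.
  - exact: computable_id.
move: C; congr computable; apply/funext => x.
by rewrite -syms_const_cat syms_comp [RHS]/= !foldr_cat.
Qed.

Lemma pickle_prog (p : prog) : pickle p = foldr stp 0 (syms (@pickle (nat + nat)%type) p).
Proof. exact: erefl. Qed.

(** The s-m-n theorem: with [x] hard-wired by [pconst], the program of index [h x] ignores its
    input, so the diagonal question of the jump becomes a question about [q] at [x]. *)
Lemma smn q : exists2 h, computable h &
  forall X x, tjump X (h x) <-> exists v, eval X q x v.
Proof.
exists (fun x => pickle (PComp q (pconst x))).
  have -> : (fun x => pickle (PComp q (pconst x))) =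
    (fun x => foldr stp 0 (syms (@pickle (nat + nat)%type) (PComp q (pconst x)))).
    by apply/funext => x; rewrite pickle_prog.
  exact: computable_syms_comp_const.
move=> X x; split=> [/asboolP[v [p]]|[v H]].
  rewrite /prog_of pickleK => -[<-] /eval_comp_inv[y Hy Hv].
  by exists v; rewrite (eval_det (eval_const X x _) Hy).
apply/asboolP; exists v; exists (PComp q (pconst x)); first by rewrite /prog_of pickleK.
exact: ev_comp (eval_const _ _ _) H.
Qed.

(** * Turing reducibility *)

Fixpoint psubst (q p : prog) : prog :=
  match p with
  | POracle => q
  | PComp f g => PComp (psubst q f) (psubst q g)
  | PPair f g => PPair (psubst q f) (psubst q g)
  | PRec f g => PRec (psubst q f) (psubst q g)
  | PMu f => PMu (psubst q f)
  | p => p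
  end.

Lemma eval_psubst (X Y : set_nat) q : (forall x, eval Y q x (X x)) ->
  forall p x v, eval X p x v -> eval Y (psubst q p) x v.
Proof.
move=> Hq; apply: (@eval_mind X (fun p x v _ => eval Y (psubst q p) x v)
  (fun p x i n _ => search Y (psubst q p) x i n)) => //=.
- exact: ev_zero.
- exact: ev_succ.
- exact: ev_id.
- exact: ev_fst.
- exact: ev_snd.
- by move=> f g x y z _ IH1 _ IH2; exact: ev_comp IH1 IH2.
- by move=> f g x y z _ IH1 _ IH2; exact: ev_pair IH1 IH2.
- by move=> f g y v _ IH; exact: ev_rec0.
- by move=> f g n y u v _ IH1 _ IH2; exact: ev_recS IH1 IH2.
- by move=> f x n _ IH; exact: ev_mu.
- by move=> f x i _ IH; exact: se_found.
- by move=> f x i k n _ IH1 _ IH2; exact: se_next IH1 IH2.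
Qed.

Lemma Tred_trans X Y W : Tred X Y -> Tred Y W -> Tred X W.
Proof. by move=> [p Hp] [q Hq]; exists (psubst q p) => x; exact: eval_psubst (Hp x). Qed.

Lemma Tred_refl X : Tred X X.
Proof. by exists POracle => x; exact: ev_oracle. Qed.

Lemma Tred_cf (X : set_nat) h : computable h -> Tred (fun x => X (h x)) X.
Proof. by move=> [p Hp]; exists (PComp POracle p) => x; exact: ev_comp (Hp _ _) (ev_oracle _ _). Qed.

Lemma search_found X p x i n : search X p x i n -> eval X p (cpair n x) 0.
Proof. by elim. Qed.

Lemma search_total X p F x : (forall i, eval X p (cpair i x) (F i)) ->
  (exists w, eval X (PMu p) x w) <-> exists i, F i = 0.
Proof.
move=> H; split=> [[w Hw]|].
  inversion Hw as [ | | | | | | | | | |f' x' n' S ]; subst; exists w.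
  exact: eval_det (H w) (search_found S).
move=> ex; have ex' : exists i, F i == 0 by case: ex => i Hi; exists i; apply/eqP.
case: (ex_minnP ex') => n /eqP Fn min; exists n; apply: ev_mu.
(* The search is built backwards from the least zero [n]. *)
have step k : k <= n -> search X p x (n - k) n.
  elim: k => [_|k IH lt]; first by rewrite subn0; apply: se_found; rewrite -Fn.
  case E: (F (n - k.+1)) => [|j].
    by have := min (n - k.+1); rewrite E => /(_ isT); lia.
  apply: (@se_next _ _ _ _ j); first by rewrite -E.
  have -> : (n - k.+1).+1 = n - k by lia.
  by apply: IH; lia.
by have := step n (leqnn n); rewrite subnn.
Qed.

(** An unbounded search halts exactly when a witness exists. The order of quantifiers matters: [h]
    depends on [p] alone, not on the oracle. *)
Lemma jump_decides_ex p : exists2 h, computable h &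
  forall X (Q : nat -> bool), (forall x, eval X p x (Q x)) ->
  forall x, tjump X (h x) <-> exists i, Q (cpair x i).
Proof.
have [t Ht] : computable (fun z => z == 0 : bool) by apply: computable_eq (computable_const _); exact: computable_id.
have [sw Hsw] : computable (fun z => cpair (csnd z) (cfst z)).
  by apply: computable_pair; [apply: computable_snd | apply: computable_fst]; exact: computable_id.
have [h ch Hh] := smn (PMu (PComp t (PComp p sw))).
exists h => // X Q HQ x.
pose F i : nat := (nat_of_bool (Q (cpair x i)) == 0).
have HF i : eval X (PComp t (PComp p sw)) (cpair i x) (F i).
  apply: ev_comp (Ht _ _); apply: ev_comp (HQ _).
  by have := Hsw X (cpair i x); rewrite cfstK csndK.
rewrite Hh (search_total HF); split=> -[i].
  by rewrite /F => Hi; exists i; move: Hi; case: (Q _).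
by move=> Hi; exists i; rewrite /F Hi.
Qed.

(** A decidable question is an existential one with a dummy witness. This turns computations from an
    iterated jump of a generic set into literals one level higher. *)
Lemma jump_query p : exists2 h, computable h &
  forall X (Q : set_nat), (forall x, eval X p x (Q x)) ->
  forall x, tjump X (h x) = Q x.
Proof.
have [f cff] : computable (fun z => cfst z) by apply: computable_fst; exact: computable_id.
have [h ch Hh] := jump_decides_ex (PComp p f).
exists h => // X Q HQ x.
have H : forall z, eval X (PComp p f) z (Q (cfst z)).
  by move=> z; apply: ev_comp (HQ _).
apply/idP/idP => [/(Hh X (fun z => Q (cfst z)) H x)[i]|Qx]; first by rewrite cfstK.
by apply/(Hh X (fun z => Q (cfst z)) H x); exists 0; rewrite cfstK.
Qed.

Lemma Tred_tj X : Tred X (tjump X).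
Proof.
have [h ch Hh] := jump_query POracle.
have E : X = (fun x => tjump X (h x)).
  by apply/funext => x; rewrite (Hh X X) // => y; exact: ev_oracle.
by rewrite {1}E; exact: Tred_cf.
Qed.

Lemma Tred_jumps X n m : n <= m -> Tred (iter n tjump X) (iter m tjump X).
Proof.
move=> /subnK <-; elim: (m - n) => [|k IH]; first exact: Tred_refl.
exact: Tred_trans IH (Tred_tj _).
Qed.

(** * Arithmetical relations *)

Definition arith (Y : set_nat) (Q : nat -> Prop) :=
  exists n, Tred (fun x => `[< Q x >]) (iter n tjump Y).

Section ArClosure.
Variable Y : set_nat.

Lemma arith_ext (Q Q' : nat -> Prop) : (forall x, Q x <-> Q' x) -> arith Y Q -> arith Y Q'.
Proof. by move=> E; have -> : Q = Q' by apply/funext => x; apply/propext. Qed.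

Lemma arith_sub Q f : arith Y Q -> computable f -> arith Y (fun z => Q (f z)).
Proof. by move=> [n H] cff; exists n; apply: Tred_trans H; exact: (@Tred_cf (fun x => `[< Q x >])). Qed.

Lemma arith_dec (b : nat -> bool) : computable (fun z => b z) -> arith Y (fun z => b z).
Proof. by move=> [p Hp]; exists 0; exists p => x; rewrite asboolb. Qed.

Lemma arith_eq f g : computable f -> computable g -> arith Y (fun z => f z = g z).
Proof.
move=> c1 c2; apply: arith_ext (arith_dec (computable_eq c1 c2)) => x.
by split=> [/eqP|->].
Qed.

Lemma arith_leq f g : computable f -> computable g -> arith Y (fun z => f z <= g z).
Proof. by move=> c1 c2; exact: arith_dec (computable_leq c1 c2). Qed.

Lemma arith_boolop (b : bool -> bool -> bool) Q1 Q2 : arith Y Q1 -> arith Y Q2 ->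
  arith Y (fun z => b `[< Q1 z >] `[< Q2 z >]).
Proof.
move=> [n1 H1] [n2 H2]; exists (maxn n1 n2).
have {H1}[p1 H1] := Tred_trans H1 (Tred_jumps Y (leq_maxl n1 n2)).
have {H2}[p2 H2] := Tred_trans H2 (Tred_jumps Y (leq_maxr n1 n2)).
have [t Ht] : computable (fun z => if cfst z is _.+1 then (if csnd z is _.+1 then b true true else b true false) else if csnd z is _.+1 then b false true else b false false : nat).
  by do !apply: computable_if; do ?exact: computable_const; [apply: computable_fst|apply: computable_snd|apply: computable_snd]; exact: computable_id.
exists (PComp t (PPair p1 p2)) => x; rewrite asboolb.
have := ev_comp (ev_pair (H1 x) (H2 x)) (Ht _ _); rewrite cfstK csndK.
by case: (asbool (Q1 x)); case: (asbool (Q2 x)).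
Qed.

Lemma arith_and Q1 Q2 : arith Y Q1 -> arith Y Q2 -> arith Y (fun z => Q1 z /\ Q2 z).
Proof.
move=> H1 H2; apply: arith_ext (arith_boolop andb H1 H2) => x.
by split=> [/andP[/asboolP ? /asboolP]|[? ?]] //; apply/andP; split; apply/asboolP.
Qed.

Lemma arith_not Q1 : arith Y Q1 -> arith Y (fun z => ~ Q1 z).
Proof.
move=> H1; apply: arith_ext (arith_boolop (fun a _ => ~~ a) H1 H1) => x.
by split=> /asboolPn.
Qed.

Lemma arith_or Q1 Q2 : arith Y Q1 -> arith Y Q2 -> arith Y (fun z => Q1 z \/ Q2 z).
Proof.
move=> H1 H2; apply: arith_ext (arith_boolop orb H1 H2) => x.
by split=> [/orP[] /asboolP|[] ?]; [left|right|apply/orP; left; apply/asboolP|apply/orP; right; apply/asboolP].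
Qed.

Lemma arith_imp Q1 Q2 : arith Y Q1 -> arith Y Q2 -> arith Y (fun z => Q1 z -> Q2 z).
Proof.
move=> H1 H2; apply: arith_ext (arith_boolop implb H1 H2) => x.
split=> [/implyP H ?|H]; first by apply/asboolP/H/asboolP.
by apply/implyP => /asboolP ?; apply/asboolP/H.
Qed.

Lemma arith_iff Q1 Q2 : arith Y Q1 -> arith Y Q2 -> arith Y (fun z => Q1 z <-> Q2 z).
Proof. by move=> H1 H2; apply: arith_and; exact: arith_imp. Qed.

(** A quantifier costs one jump; only the finiteness of the total will matter. *)
Lemma arith_ex (F : nat -> nat -> Prop) :
  arith Y (fun z => F (cfst z) (csnd z)) -> arith Y (fun z => exists y, F z y).
Proof.
move=> [n [p Hp]]; have [h ch Hh] := jump_decides_ex p; exists n.+1.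
have := Tred_cf (tjump (iter n tjump Y)) ch; congr Tred; apply/funext => x.
apply/idP/asboolP => [/(Hh _ _ Hp)[i /asboolP]|[i Hi]].
  by rewrite cfstK csndK; exists i.
by apply/(Hh _ _ Hp); exists i; apply/asboolP; rewrite cfstK csndK.
Qed.

Lemma arith_all (F : nat -> nat -> Prop) :
  arith Y (fun z => F (cfst z) (csnd z)) -> arith Y (fun z => forall y, F z y).
Proof.
move=> H; have := arith_not (arith_ex (F := fun z y => ~ F z y) (arith_not H)).
apply: arith_ext => x; split=> [H' y|H' [y]]; last by apply; exact: H'.
by apply: contrapT => H''; apply: H'; exists y.
Qed.

Lemma arith_oracle f : computable f -> arith Y (fun z => Y (f z)).
Proof.
move=> cff; apply: (arith_sub (Q := fun x => Y x)) cff; exists 0.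
by exists POracle => x; rewrite asboolb; exact: ev_oracle.
Qed.

Lemma arith_sub2 (F : nat -> nat -> Prop) f g : arith Y (fun z => F (cfst z) (csnd z)) ->
  computable f -> computable g -> arith Y (fun z => F (f z) (g z)).
Proof.
move=> H c1 c2; have := arith_sub H (computable_pair c1 c2).
by apply: arith_ext => x; rewrite cfstK csndK.
Qed.

Lemma arith_true (Q : Prop) : arith Y (fun _ => Q).
Proof.
exists 0; exists (pconst `[< Q >]) => x; exact: eval_const.
Qed.

End ArClosure.

Lemma arith_tj Y Q : arith Y Q -> arith (tjump Y) Q.
Proof.
move=> [n H]; exists n; apply: Tred_trans H _.
by rewrite -iterSr; exact: Tred_jumps.
Qed.

(** * Finite sequences coded by numbers *)

Definition csize c := cfst c.
Definition cnth c i := cfst (iter i csnd (csnd c)).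

Lemma computable_cnth f g : computable f -> computable g -> computable (fun z => cnth (f z) (g z)).
Proof.
move=> c1 c2; apply: computable_fst; apply: computable_iter => //; last exact: computable_snd.
by apply: computable_snd; exact: computable_id.
Qed.

Lemma cseqP (f : nat -> nat) n :
  exists c, csize c = n /\ forall i, i < n -> cnth c i = f i.
Proof.
suff [d Hd] : exists d, forall i, i < n -> cfst (iter i csnd d) = f i.
  by exists (cpair n d); split=> [|i /Hd]; rewrite /csize /cnth ?cfstK // csndK.
elim: n f => [|n IH] f; first by exists 0.
have [d Hd] := IH (fun i => f i.+1); exists (cpair (f 0) d) => -[|i] lt.
  by rewrite /= cfstK.
by rewrite iterSr csndK Hd.
Qed.

Lemma computable_expc c f : computable f -> computable (fun z => c ^ f z).
Proof.
move=> c1; have := computable_expc_mul c c1 (computable_const 1).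
by congr computable; apply/funext => z; rewrite muln1.
Qed.

Ltac cfs := repeat lazymatch goal with
  | |- computable (fun _ => ?t) => apply computable_const
  | |- computable (fun z => z) => apply computable_id
  | |- computable cfst => apply (computable_fst computable_id)
  | |- computable csnd => apply (computable_snd computable_id)
  | |- computable csize => apply (computable_fst computable_id)
  | |- computable S => apply (computable_succ computable_id)
  | |- computable (fun z => cpair _ _) => apply computable_pair
  | |- computable (fun z => cfst _) => apply computable_fst
  | |- computable (fun z => csnd _) => apply computable_snd
  | |- computable (fun z => csize _) => apply computable_fst
  | |- computable (fun z => cnth _ _) => apply computable_cnth
  | |- computable (fun z => S _) => apply computable_succ
  | |- computable (fun z => addn _ _) => apply computable_add
  | |- computable (fun z => stp _ _) => apply computable_stp
  | |- computable (fun z => muln (expn ?n _) _) => apply computable_expc_mul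
  | |- computable (fun z => muln ?n _) => apply computable_mulc
  | |- computable (fun z => expn ?n _) => apply computable_expc
  | H : computable ?f |- computable ?f => exact H
  | H : computable ?f |- computable (fun z => ?f _) => apply (computable_comp H)
  end.

(** Reads off from its connectives that a formula is arithmetical. The universal quantifier comes
    last, since an implication is a product too. *)
Ltac ars := repeat (cbv beta; lazymatch goal with
  | |- arith _ (fun _ => ?t) => apply arith_true
  | |- arith _ (fun z => _ /\ _) => apply arith_and
  | |- arith _ (fun z => _ \/ _) => apply arith_or
  | |- arith _ (fun z => _ <-> _) => apply arith_iff
  | |- arith _ (fun z => ~ _) => apply arith_not
  | |- arith _ (fun z => exists y, @?F z y) => apply (arith_ex (F := F))
  | |- arith _ (fun z => is_true (leq _ _)) => apply arith_leq; cfs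
  | |- arith _ (fun z => @eq nat _ _) => apply arith_eq; cfs
  | H : arith ?Y (fun z => ?M (cfst z) (csnd z)) |- arith ?Y (fun z => ?M (@?f z) (@?g z)) =>
      apply (arith_sub2 (f := f) (g := g) H); cfs
  | H : arith ?Y (fun z => is_true (?X z)) |- arith ?Y (fun z => is_true (?X (@?f z))) =>
      apply (arith_sub (Q := fun z => is_true (X z)) (f := f) H); cfs
  | H : arith ?Y (fun z => ?M z) |- arith ?Y (fun z => ?M (@?f z)) =>
      apply (arith_sub (f := f) H); cfs
  | |- arith _ (fun z => @?A z -> @?B z) => apply (arith_imp (Q1 := A) (Q2 := B))
  | |- arith _ (fun z => forall y, @?F z y) => apply (arith_all (F := F))
  end).

(** * Certificates for computations *)

(** A second numbering of syntax trees besides [pickle], built from [cpair] so that derivation rules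
    are plainly arithmetical; in lists, 0 is the empty one and the successor marks a cons. *)
Fixpoint tcode (t : GenTree.tree nat) : nat :=
  match t with
  | GenTree.Leaf x => cpair 0 x
  | GenTree.Node n f => cpair n.+1 (foldr (fun t r => (cpair (tcode t) r).+1) 0 f)
  end.
Definition fcode (fs : seq (GenTree.tree nat)) :=
  foldr (fun t r => (cpair (tcode t) r).+1) 0 fs.
Definition scode (s : seq (seq (GenTree.tree nat))) :=
  foldr (fun fs r => (cpair (fcode fs) r).+1) 0 s.
Definition pcode p := tcode (prog_enc p).

Lemma tcode_inj : injective tcode.
Proof.
elim=> [x|n f IH] [y|m g] /= /cpair_inj[] //; first by move=> _ ->.
case=> <- E; congr GenTree.Node.
elim: f g IH E => [|t f IHf] [|u g] //= [IHt IHs] [] /cpair_inj[/IHt <- E].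
by congr cons; apply: IHf.
Qed.

Lemma pcode_inj : injective pcode.
Proof. by move=> p q /tcode_inj E; apply: (pcan_inj prog_encK). Qed.

Lemma prog_decK t p : prog_dec t = Some p -> t = prog_enc p.
Proof.
move: t p; fix IH 1 => -[x|n f] p //.
move: n f => [|[|[|[|[|[|[|[|[|[|n]]]]]]]]]] [|a [|b [|c f]]] //=.
1-6: by move=> [<-].
1-3: by case Ea: (prog_dec a) => [u|] //; case Eb: (prog_dec b) => [v|] // [<-];
  rewrite (IH _ _ Ea) (IH _ _ Eb).
by case Ea: (prog_dec a) => [u|] // [<-]; rewrite (IH _ _ Ea).
Qed.

Definition nd0 n := cpair n.+1 0.
Definition nd1 n a := cpair n.+1 (cpair a 0).+1.
Definition nd2 n a b := cpair n.+1 (cpair a (cpair b 0).+1).+1.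

Definition symN (v : nat) := @unpickle (nat + nat)%type v = None.
Definition symL (v n : nat) := @unpickle (nat + nat)%type v = Some (inl n).
Definition symR (v n : nat) := @unpickle (nat + nat)%type v = Some (inr n).

(** The parser step [GenTree.decode_step] on codes. Symbols are read from the right: a closing one
    pushes the current forest on the stack, an opening one wraps it into a node and pops, a leaf
    joins it. *)
Definition SymStep v f st f' st' : Prop :=
  (symN v /\ f' = f /\ st' = st) \/
  (symL v 0 /\ f' = 0 /\ st' = (cpair f st).+1) \/
  (exists n, symL v n.+1 /\
     ((st = 0 /\ f' = (cpair (cpair n.+1 f) 0).+1 /\ st' = 0) \/
      (exists g s, st = (cpair g s).+1 /\
         f' = (cpair (cpair n.+1 f) g).+1 /\ st' = s))) \/
  (exists x, symR v x /\ f' = (cpair (cpair 0 x) f).+1 /\ st' = st).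

Definition judgement k t x v := cpair k (cpair t (cpair x v)).

(* Judgements: [judgement 0 m f st]: parsing the symbol sequence [m] leaves the parser
   in state [(f, st)]; [judgement 1 t 0 0]: [t] codes a program; [judgement 2 t x v]: it maps
   [x] to [v]; [judgement 3 t x (i, n)]: its search at [x] from [i] returns [n]. *)
Definition Step (s : nat) (Q : nat -> Prop) (j : nat) : Prop :=
  j = judgement 0 0 0 0
  \/ (exists m f st v f' st', Q (judgement 0 m f st) /\ SymStep v f st f' st' /\
        j = judgement 0 (stp v m) f' st')
  \/ (exists n, n <= 5 /\ j = judgement 1 (nd0 n) 0 0)
  \/ (exists n a b, 6 <= n /\ n <= 8 /\ Q (judgement 1 a 0 0) /\ Q (judgement 1 b 0 0) /\
        j = judgement 1 (nd2 n a b) 0 0)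
  \/ (exists a, Q (judgement 1 a 0 0) /\ j = judgement 1 (nd1 9 a) 0 0)
  \/ (exists x, j = judgement 2 (nd0 0) x 0)
  \/ (exists x, j = judgement 2 (nd0 1) x x.+1)
  \/ (exists x, j = judgement 2 (nd0 2) x x)
  \/ (exists x, j = judgement 2 (nd0 3) x (cfst x))
  \/ (exists x, j = judgement 2 (nd0 4) x (csnd x))
  \/ (exists x, x < csize s /\ j = judgement 2 (nd0 5) x (cnth s x))
  \/ (exists a b x y z, Q (judgement 2 b x y) /\ Q (judgement 2 a y z) /\
        j = judgement 2 (nd2 6 a b) x z)
  \/ (exists a b x y z, Q (judgement 2 a x y) /\ Q (judgement 2 b x z) /\
        j = judgement 2 (nd2 7 a b) x (cpair y z))
  \/ (exists a b y v, Q (judgement 2 a y v) /\ Q (judgement 1 b 0 0) /\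
        j = judgement 2 (nd2 8 a b) (cpair 0 y) v)
  \/ (exists a b n y u v, Q (judgement 1 a 0 0) /\ Q (judgement 2 (nd2 8 a b) (cpair n y) u) /\
        Q (judgement 2 b (cpair n (cpair u y)) v) /\
        j = judgement 2 (nd2 8 a b) (cpair n.+1 y) v)
  \/ (exists a x n, Q (judgement 3 a x (cpair 0 n)) /\ j = judgement 2 (nd1 9 a) x n)
  \/ (exists a x i, Q (judgement 2 a (cpair i x) 0) /\ j = judgement 3 a x (cpair i i))
  \/ (exists a x i k n, Q (judgement 2 a (cpair i x) k.+1) /\
        Q (judgement 3 a x (cpair i.+1 n)) /\ j = judgement 3 a x (cpair i n)).

(** A derivation is one number whose entries are justified by later entries, so only number
    quantifiers occur. *)
Definition derivable (s j : nat) : Prop := exists L,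
  (forall i, i < csize L ->
     Step s (fun j' => exists i', i < i' /\ i' < csize L /\ cnth L i' = j') (cnth L i)) /\
  exists i, i < csize L /\ cnth L i = j.

Lemma Step_mono s (Q Q' : nat -> Prop) j : (forall i, Q i -> Q' i) -> Step s Q j -> Step s Q' j.
Proof.
move=> QQ'; rewrite /Step.
repeat (case=> [H|H]; [left|right; move: H]); last move=> H;
  repeat match goal with
   | H : exists _, _ |- _ => let x := fresh "x" in case: H => x H; exists x
   end; intuition auto.
Qed.

Lemma derivable_ind s (Q : nat -> Prop) : (forall j, Step s Q j -> Q j) -> forall j, derivable s j -> Q j.
Proof.
move=> HQ j [L [V [i [lt <-]]]].
have [m le] := ubnP (csize L - i); elim: m i lt le => // m IH i lt le.
apply: HQ; apply: Step_mono (V i lt) => _ [i' [l1 [l2 <-]]].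
by apply: IH => //; lia.
Qed.

Fixpoint valid_cert s (l : seq nat) : Prop :=
  if l is j :: l' then Step s (fun i => i \in l') j /\ valid_cert s l' else True.

Lemma valid_cert_cat s l1 l2 : valid_cert s l1 -> valid_cert s l2 -> valid_cert s (l1 ++ l2).
Proof.
elim: l1 => //= j l IH [S V] V2; split; last exact: IH.
by apply: Step_mono S => i il; rewrite mem_cat il.
Qed.

Lemma valid_cert_nth s l i : valid_cert s l -> i < size l ->
  Step s (fun j => exists i', i < i' /\ i' < size l /\ nth 0 l i' = j) (nth 0 l i).
Proof.
elim: l i => //= j l IH [|i] [S V] lt.
  apply: Step_mono S => k kl; exists (index k l).+1; split=> //.
  by rewrite /= nth_index // ltnS index_mem.
apply: Step_mono (IH i V lt) => k [i' [l1 [l2 E]]].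
by exists i'.+1.
Qed.

Lemma nth_valid_cert s l : (forall i, i < size l ->
  Step s (fun j => exists i', i < i' /\ i' < size l /\ nth 0 l i' = j) (nth 0 l i)) ->
  valid_cert s l.
Proof.
elim: l => //= j l IH H; split.
  by apply: Step_mono (H 0 isT) => k [[|i'] [] // _ [lt <-]]; exact: (@mem_nth _ 0 l i').
apply: IH => i lt; apply: Step_mono (H i.+1 lt) => k [[|i'] [] // l1 [l2 E]].
by exists i'.
Qed.

Lemma derivableP s j : derivable s j <-> exists2 l, valid_cert s l & j \in l.
Proof.
split=> [[L [V [i [lt <-]]]]|[l V jl]].
  exists (mkseq (cnth L) (csize L)); last by apply: map_f; rewrite mem_iota.
  apply: nth_valid_cert => k; rewrite size_mkseq => ltk; rewrite nth_mkseq //.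
  apply: Step_mono (V k ltk) => m [i' [l1 [l2 E]]]; exists i'.
  by rewrite nth_mkseq.
have [L [sL nL]] := cseqP (nth 0 l) (size l); exists L; rewrite sL; split.
  move=> i lt; rewrite nL //; apply: Step_mono (valid_cert_nth V lt) => k [i' [l1 [l2 E]]].
  by exists i'; rewrite nL.
by exists (index j l); rewrite index_mem nL ?index_mem ?nth_index.
Qed.

(** Certificates of the premises are concatenated and the conclusion is put in front. *)
Lemma derivable_intro s j (js : seq nat) : (forall i, i \in js -> derivable s i) ->
  Step s (fun i => i \in js) j -> derivable s j.
Proof.
move=> H S; suff [l V sub] : exists2 l, valid_cert s l & {subset js <= l}.
  apply/derivableP; exists (j :: l); last by rewrite inE eqxx.
  by split=> //; apply: Step_mono S => i /sub.
elim: js {S} H => [|i js IH] H; first by exists [::].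
have [k kjs|l V sub] := IH; first by apply: H; rewrite inE kjs orbT.
have /derivableP[l' V' il'] := H i (mem_head _ _).
exists (l' ++ l); first exact: valid_cert_cat.
by move=> k; rewrite inE mem_cat => /orP[/eqP->|/sub->]; rewrite ?il' ?orbT.
Qed.

(** Holds by conversion; it exposes the passage from number to symbols to forest to program that the
    parsing judgements imitate. *)
Lemma prog_ofE k : prog_of k =
  obind prog_dec (ohead (foldr (@GenTree.decode_step nat) ([::], [::])
    (pmap (@unpickle (nat + nat)%type) (CodeSeq.decode k))).1).
Proof. exact: erefl. Qed.

Definition parse (l : seq nat) := foldr (@GenTree.decode_step nat) ([::], [::])
    (pmap (@unpickle (nat + nat)%type) l).

Lemma SymStepP v l f' st' :
  SymStep v (fcode (parse l).1) (scode (parse l).2) f' st' <->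
  f' = fcode (parse (v :: l)).1 /\ st' = scode (parse (v :: l)).2.
Proof.
rewrite /SymStep /parse /= /symN /symL /symR.
case: (@unpickle (nat + nat)%type v) => [[[|n]|x]|] /=;
  set st := foldr _ _ _; case: st => fs ss /=.
- split=> [|[-> ->]]; last by right; left.
  case=> [[//]|[[_ ?] //|[[n [//]]|[x [//]]]]].
- split=> [|[-> ->]].
    case=> [[//]|[[//]|[[m [[<-]]]|[x [//]]]]].
    case=> [[E [-> ->]]|[g [s [E [-> ->]]]]]; case: ss E => //= h ss [] /cpair_inj[-> ->] //.
  right; right; left; exists n; split=> //; case: ss => [|g ss] /=; first by left.
  by right; exists (fcode g), (scode ss).
- split=> [|[-> ->]]; last by right; right; right; exists x.
  by case=> [[//]|[[//]|[[n [//]]|[y [[<-] ?]]]]].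
- split=> [|[-> ->]]; last by left.
  by case=> [[_ ?]|[[//]|[[n [//]]|[x [//]]]]].
Qed.

Definition agree (s : nat) (X : set_nat) := forall i, i < csize s -> cnth s i = X i.

Lemma stpE v m : stp v m = CodeSeq.code (v :: CodeSeq.decode m).
Proof. by rewrite /= CodeSeq.decodeK. Qed.

Definition meaning (X : set_nat) (j : nat) : Prop :=
  let k := cfst j in let t := cfst (csnd j) in
  let x := cfst (csnd (csnd j)) in let v := csnd (csnd (csnd j)) in
  (k = 0 -> x = fcode (parse (CodeSeq.decode t)).1 /\ v = scode (parse (CodeSeq.decode t)).2) /\
  (k = 1 -> exists p, t = pcode p) /\
  (k = 2 -> exists p, t = pcode p /\ eval X p x v) /\
  (k = 3 -> exists p, t = pcode p /\ search X p x (cfst v) (csnd v)).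

Lemma meaningE X k t x v : meaning X (judgement k t x v) <->
  match k with
  | 0 => x = fcode (parse (CodeSeq.decode t)).1 /\ v = scode (parse (CodeSeq.decode t)).2
  | 1 => exists p, t = pcode p
  | 2 => exists p, t = pcode p /\ eval X p x v
  | 3 => exists p, t = pcode p /\ search X p x (cfst v) (csnd v)
  | _ => True
  end.
Proof.
rewrite /meaning /judgement !(cfstK, csndK).
split=> [[H0 [H1 [H2 H3]]]|]; first by move: k H0 H1 H2 H3 => [|[|[|[|k]]]] H0 H1 H2 H3 //; auto.
by move: k => [|[|[|[|k]]]] H; split=> //; split=> //; split.
Qed.

Lemma derivable_sound s X : agree s X -> forall j, derivable s j -> meaning X j.
Proof.
move=> ag; apply: derivable_ind => j; rewrite /Step.
case=> [->|]; first by apply/meaningE.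
case=> [[m [f [st [v [f' [st' [/meaningE[-> ->] [/SymStepP[-> ->] ->]]]]]]]]|].
  by apply/meaningE; rewrite stpE CodeSeq.codeK.
case=> [[n [le ->]]|].
  apply/meaningE; move: n le => [|[|[|[|[|[|n]]]]]] // _.
  - by exists PZero. - by exists PSucc. - by exists PId. - by exists PFst.
  - by exists PSnd. - by exists POracle.
case=> [[n [a [b [l1 [l2 [/meaningE[p ->] [/meaningE[q ->] ->]]]]]]]|].
  apply/meaningE; move: n l1 l2 => [|[|[|[|[|[|[|[|[|n]]]]]]]]] // _ _.
  - by exists (PComp p q). - by exists (PPair p q). - by exists (PRec p q).
case=> [[a [/meaningE[p ->] ->]]|]; first by apply/meaningE; exists (PMu p).
case=> [[x ->]|]; first by apply/meaningE; exists PZero; split=> //; exact: ev_zero.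
case=> [[x ->]|]; first by apply/meaningE; exists PSucc; split=> //; exact: ev_succ.
case=> [[x ->]|]; first by apply/meaningE; exists PId; split=> //; exact: ev_id.
case=> [[x ->]|]; first by apply/meaningE; exists PFst; split=> //; exact: ev_fst'.
case=> [[x ->]|]; first by apply/meaningE; exists PSnd; split=> //; exact: ev_snd'.
case=> [[x [lt ->]]|].
  by apply/meaningE; exists POracle; split=> //; rewrite ag //; exact: ev_oracle.
case=> [[a [b [x [y [z [/meaningE[p [-> Hp]] [/meaningE[q [-> Hq]] ->]]]]]]]|].
  by apply/meaningE; exists (PComp q p); split=> //; exact: ev_comp Hp Hq.
case=> [[a [b [x [y [z [/meaningE[p [-> Hp]] [/meaningE[q [-> Hq]] ->]]]]]]]|].
  by apply/meaningE; exists (PPair p q); split=> //; exact: ev_pair Hp Hq.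
case=> [[a [b [y [v [/meaningE[p [-> Hp]] [/meaningE[q ->] ->]]]]]]|].
  by apply/meaningE; exists (PRec p q); split=> //; exact: ev_rec0.
case=> [[a [b [n [y [u [v [/meaningE[p ->] [/meaningE[r [Er Hr]] [/meaningE[q [Eq Hq]] ->]]]]]]]]]|].
  (* The premise on the previous value speaks of some program [r]; injectivity of [pcode] identifies
     it with [PRec p q]. *)
  subst b; apply/meaningE; exists (PRec p q); split=> //; apply: ev_recS Hq.
  by rewrite (_ : PRec p q = r) //; apply: pcode_inj; rewrite -Er.
case=> [[a [x [n [/meaningE[p [-> Hp]] ->]]]]|].
  by apply/meaningE; exists (PMu p); split=> //; apply: ev_mu; rewrite cfstK csndK in Hp.
case=> [[a [x [i [/meaningE[p [-> Hp]] ->]]]]|].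
  by apply/meaningE; exists p; split=> //; rewrite cfstK csndK; exact: se_found.
case=> [a [x [i [k [n [/meaningE[p [-> Hp]] [/meaningE[q [/pcode_inj <- Hq]] ->]]]]]]].
apply/meaningE; exists p; split=> //; rewrite cfstK csndK in Hq *.
by rewrite cfstK csndK; exact: se_next Hp Hq.
Qed.

Lemma derivable_parse s l :
  derivable s (judgement 0 (CodeSeq.code l) (fcode (parse l).1) (scode (parse l).2)).
Proof.
elim: l => [|v l IH]; first by apply: (@derivable_intro _ _ [::]) => //; left.
apply: (@derivable_intro _ _ [:: judgement 0 (CodeSeq.code l) (fcode (parse l).1) (scode (parse l).2)]).
  by move=> i; rewrite inE => /eqP->.
right; left; exists (CodeSeq.code l), (fcode (parse l).1), (scode (parse l).2), v.
exists (fcode (parse (v :: l)).1), (scode (parse (v :: l)).2).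
by rewrite inE eqxx; split=> //; split=> //; apply/SymStepP.
Qed.

Tactic Notation "rule" integer(n) := do n right; try left.
Ltac dintro1 H := match type of H with derivable _ ?a => apply: (@derivable_intro _ _ [:: a]);
  first by let i := fresh "i" in move=> i; rewrite inE => /eqP-> end.
Ltac dintro2 H1 H2 := match type of H1 with derivable _ ?a => match type of H2 with derivable _ ?b =>
  apply: (@derivable_intro _ _ [:: a; b]);
  first by let i := fresh "i" in move=> i; rewrite !inE => /orP[]/eqP-> end end.
Ltac mem := rewrite ?inE ?eqxx ?orbT.

(** Supplies the side premises of the recursion rules, where the branch not evaluated must still
    code a program. *)
Lemma derivable_isprog s p : derivable s (judgement 1 (pcode p) 0 0).
Proof.
elim: p => [||||||f IHf g IHg|f IHf g IHg|f IHf g IHg|f IHf].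
1-6: apply: (@derivable_intro _ _ [::]) => //; rule 2.
- by exists 0. - by exists 1. - by exists 2. - by exists 3. - by exists 4. - by exists 5.
- by dintro2 IHf IHg; rule 3; exists 6, (pcode f), (pcode g); mem.
- by dintro2 IHf IHg; rule 3; exists 7, (pcode f), (pcode g); mem.
- by dintro2 IHf IHg; rule 3; exists 8, (pcode f), (pcode g); mem.
- by dintro1 IHf; rule 4; exists (pcode f); mem.
Qed.

(** The use principle: a computation consults only finitely many values of the oracle, so every long
    enough initial segment certifies it. *)
Lemma derivable_complete X p x v : eval X p x v ->
  exists n, forall s, agree s X -> n <= csize s -> derivable s (judgement 2 (pcode p) x v).
Proof.
move: p x v; apply: (@eval_mind X
  (fun p x v _ => exists n, forall s, agree s X -> n <= csize s -> derivable s (judgement 2 (pcode p) x v))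
  (fun p x i m _ => exists n, forall s, agree s X -> n <= csize s ->
     derivable s (judgement 3 (pcode p) x (cpair i m)))).
- by move=> x; exists 0 => s _ _; apply: (@derivable_intro _ _ [::]) => //; rule 5; exists x.
- by move=> x; exists 0 => s _ _; apply: (@derivable_intro _ _ [::]) => //; rule 6; exists x.
- by move=> x; exists 0 => s _ _; apply: (@derivable_intro _ _ [::]) => //; rule 7; exists x.
- move=> a b; exists 0 => s _ _; apply: (@derivable_intro _ _ [::]) => //; rule 8; exists (cpair a b).
  by rewrite cfstK.
- move=> a b; exists 0 => s _ _; apply: (@derivable_intro _ _ [::]) => //; rule 9; exists (cpair a b).
  by rewrite csndK.
- move=> x; exists x.+1 => s ag lt; apply: (@derivable_intro _ _ [::]) => //; rule 10; exists x.
  by rewrite ag.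
- move=> f g x y z _ [n1 H1] _ [n2 H2]; exists (maxn n1 n2) => s ag.
  rewrite geq_max => /andP[/(H1 s ag){}H1 /(H2 s ag){}H2]; dintro2 H1 H2.
  by rule 11; exists (pcode f), (pcode g), x, y, z; mem.
- move=> f g x y z _ [n1 H1] _ [n2 H2]; exists (maxn n1 n2) => s ag.
  rewrite geq_max => /andP[/(H1 s ag){}H1 /(H2 s ag){}H2]; dintro2 H1 H2.
  by rule 12; exists (pcode f), (pcode g), x, y, z; mem.
- move=> f g y v _ [n H]; exists n => s ag /(H s ag){}H.
  have H2 := derivable_isprog s g; dintro2 H H2.
  by rule 13; exists (pcode f), (pcode g), y, v; mem.
- move=> f g n y u v _ [n1 H1] _ [n2 H2]; exists (maxn n1 n2) => s ag.
  rewrite geq_max => /andP[/(H1 s ag){}H1 /(H2 s ag){}H2].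
  have H3 := derivable_isprog s f.
  apply: (@derivable_intro _ _ [:: judgement 1 (pcode f) 0 0; judgement 2 (pcode (PRec f g)) (cpair n y) u;
     judgement 2 (pcode g) (cpair n (cpair u y)) v]).
    by move=> i; rewrite !inE => /or3P[]/eqP->.
  by rule 14; exists (pcode f), (pcode g), n, y, u, v; mem.
- move=> f x n _ [m H]; exists m => s ag /(H s ag){}H; dintro1 H.
  by rule 15; exists (pcode f), x, n; mem.
- move=> f x i _ [m H]; exists m => s ag /(H s ag){}H; dintro1 H.
  by rule 16; exists (pcode f), x, i; mem.
- move=> f x i k n _ [n1 H1] _ [n2 H2]; exists (maxn n1 n2) => s ag.
  rewrite geq_max => /andP[/(H1 s ag){}H1 /(H2 s ag){}H2]; dintro2 H1 H2.
  by rule 17; exists (pcode f), x, i, k, n; mem.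
Qed.

Definition phiC s k x v := exists t r st,
  derivable s (judgement 0 k (cpair t r).+1 st) /\ derivable s (judgement 2 t x v).

Lemma phiC_sound s X k x v : agree s X -> phiC s k x v -> phi X k x v.
Proof.
move=> ag [t [r [st [/(derivable_sound ag) /meaningE[E _] /(derivable_sound ag) /meaningE[p [Et H]]]]]].
exists p => //; rewrite prog_ofE -/(parse _).
case: (parse _).1 E => [|t0 fs] //= [] /cpair_inj[E _].
have -> : t0 = prog_enc p by apply: tcode_inj; rewrite -E.
by rewrite prog_encK.
Qed.

Lemma phiC_complete X k x v : phi X k x v -> exists n, forall s, agree s X ->
  n <= csize s -> phiC s k x v.
Proof.
move=> [p Ep /derivable_complete[n Hn]]; exists n => s ag le.
move: Ep; rewrite prog_ofE -/(parse _) => Ep.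
have H := derivable_parse s (CodeSeq.decode k); rewrite CodeSeq.decodeK in H.
move: Ep H; case: (parse _) => [[|t fs] ss] //= /prog_decK -> H.
exists (pcode p), (fcode fs), (scode ss); split=> //; exact: Hn.
Qed.

Lemma cseq_agree X n : exists s, agree s X /\ csize s = n.
Proof.
have [s [E H]] := cseqP X n; exists s; split=> // i; rewrite E; exact: H.
Qed.

Lemma agreeP s X : agree s X <-> forall i, i < csize s ->
  (X i /\ cnth s i = 1) \/ (~ X i /\ cnth s i = 0).
Proof.
split=> H i /H; first by move=> ->; case: (X i); [left|right].
by case=> -[]; case: (X i).
Qed.

(** The oracle enters only through its finite segments; hence [phi X] is arithmetical wherever
    membership in [X] is. *)
Lemma phiP X k x v : phi X k x v <-> exists s, agree s X /\ phiC s k x v.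
Proof.
split=> [/phiC_complete[n H]|[s [ag]]]; last exact: phiC_sound.
by have [s [ag E]] := cseq_agree X n; exists s; split=> //; apply: H; rewrite ?E.
Qed.

Lemma unpickle_sumE v : @unpickle (nat + nat)%type v =
  if CodeSeq.decode v is [:: a; b]
  then sum_of_opair (ohead (CodeSeq.decode a), ohead (CodeSeq.decode b)) else None.
Proof.
have pE (s : seq nat) : pmap (@Some nat) s = s by elim: s => //= a s ->.
transitivity (obind (@sum_of_opair nat nat) (omap (@pair_of_tag _ _)
  (if CodeSeq.decode v is [:: a; b] then
   obind (fun i => omap (@Tagged (option nat) i (fun _ => option nat)) 
     (omap ohead (Some (pmap (@Some nat) (CodeSeq.decode b)))))
     (omap ohead (Some (pmap (@Some nat) (CodeSeq.decode a)))) else None))); first exact: erefl.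
by case: (CodeSeq.decode v) => [|a [|b [|c l]]] //=; rewrite !pE.
Qed.

Lemma ohead_decode a n : ohead (CodeSeq.decode a) = Some n <-> exists m, a = stp n m.
Proof.
split=> [|[m ->]]; last by rewrite stpE CodeSeq.codeK.
case E: (CodeSeq.decode a) => [|k l] //= [<-]; exists (CodeSeq.code l).
by rewrite -[a]CodeSeq.decodeK E.
Qed.

Lemma decode_pair v a b : CodeSeq.decode v = [:: a; b] <-> v = stp a (stp b 0).
Proof.
split=> [E|->]; first by rewrite -[v]CodeSeq.decodeK E.
by rewrite !stpE !CodeSeq.codeK.
Qed.

Lemma symRP v n : symR v n <-> exists a b m, v = stp a (stp b 0) /\ b = stp n m.
Proof.
rewrite /symR unpickle_sumE; split.
  case E: (CodeSeq.decode v) => [|a [|b [|c l]]] //; move/decode_pair: E => ->.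
  rewrite /sum_of_opair /=; case E: (ohead (CodeSeq.decode b)) => [k|] /=.
    by move=> [<-]; move/ohead_decode: E => [m ->]; exists a, (stp k m), m.
  by case: (ohead _).
move=> [a [b [m [/decode_pair -> E]]]].
have /ohead_decode : exists m, b = stp n m by exists m.
by rewrite /sum_of_opair /= => ->.
Qed.

(** A symbol is decoded as a pair of options whose second component takes precedence, whence the
    clause that [b] codes no nonempty sequence. *)
Lemma symLP v n : symL v n <-> exists a b m, v = stp a (stp b 0) /\ a = stp n m /\
  ~ exists k l, b = stp k l.
Proof.
rewrite /symL unpickle_sumE; split.
  case E: (CodeSeq.decode v) => [|a [|b [|c l]]] //; move/decode_pair: E => ->.
  rewrite /sum_of_opair /=; case E: (ohead (CodeSeq.decode b)) => [k|] //=.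
  case E': (ohead (CodeSeq.decode a)) => [k|] //= [<-].
  move/ohead_decode: E' => [m ->]; exists (stp k m), b, m; split=> //; split=> //.
  by case=> k' [l /(ex_intro (fun m => b = stp k' m)) /ohead_decode]; rewrite E.
move=> [a [b [m [/decode_pair -> [E nE]]]]].
have /ohead_decode : exists m, a = stp n m by exists m.
rewrite /sum_of_opair /= => ->; case E': (ohead (CodeSeq.decode b)) => [k|] //.
by case: nE; move/ohead_decode: E' => [l El]; exists k, l.
Qed.

Lemma symNP v : symN v <-> ~ (exists n, symL v n) /\ ~ (exists n, symR v n).
Proof.
rewrite /symN /symL /symR; split=> [->|[]]; first by split=> -[].
by case: (unpickle v) => // -[] n H1 H2; [case: H1|case: H2]; exists n.
Qed.

Section ArEval.
Variable Y : set_nat.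

Lemma arith_symR : arith Y (fun z => symR (cfst z) (csnd z)).
Proof. by apply: arith_ext (fun z => iff_sym (symRP (cfst z) (csnd z))) _; ars. Qed.

Lemma arith_symL : arith Y (fun z => symL (cfst z) (csnd z)).
Proof. by apply: arith_ext (fun z => iff_sym (symLP (cfst z) (csnd z))) _; ars. Qed.

Lemma arith_symN : arith Y (fun z => symN z).
Proof.
have H1 := arith_symR; have H2 := arith_symL.
by apply: arith_ext (fun z => iff_sym (symNP z)) _; ars.
Qed.

Lemma arith_Der : arith Y (fun z => derivable (cfst z) (csnd z)).
Proof.
have H1 := arith_symR; have H2 := arith_symL; have H3 := arith_symN.
by rewrite /derivable /Step /SymStep /judgement /nd0 /nd1 /nd2; ars.
Qed.

Lemma arith_phiC s k x v : computable s -> computable k -> computable x -> computable v ->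
  arith Y (fun z => phiC (s z) (k z) (x z) (v z)).
Proof. by have H := arith_Der; rewrite /phiC /judgement => *; ars. Qed.

Lemma arith_phi (X : set_nat) k x v : arith Y (fun z => X z) -> computable k -> computable x -> computable v ->
  arith Y (fun z => phi X (k z) (x z) (v z)).
Proof.
move=> HX ck cx cv; apply: arith_ext (fun z => iff_sym (phiP X (k z) (x z) (v z))) _.
apply: arith_ex; apply: arith_and; last by apply: arith_phiC; cfs.
by apply: arith_ext (fun z => iff_sym (agreeP (csnd z) X)) _; ars.
Qed.

End ArEval.

(** * Ordinal notations *)

Scheme inO_mind := Induction for inO Sort Prop
  with ltO_mind := Induction for ltO Sort Prop.
Combined Scheme inO_ltO_ind from inO_mind, ltO_mind.

Lemma inO_gt0 a : inO a -> 0 < a.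
Proof. by case=> [|b _|e f _ _]; rewrite ?muln_gt0 ?expn_gt0. Qed.

Lemma exp2_neq_lim a e : 2 ^ a <> 3 * 5 ^ e.
Proof.
move=> E; have := congr1 odd E; rewrite oddM !oddX orbT.
by case: a E => [|a] //= E; have := expn_gt0 5 e; lia.
Qed.

Lemma lim_inj e e' : 3 * 5 ^ e = 3 * 5 ^ e' -> e = e'.
Proof. by move=> E; apply: (@expnI 5) => //; lia. Qed.

Lemma exp2_inj a b : 2 ^ a = 2 ^ b -> a = b.
Proof. exact: expnI. Qed.

Lemma exp2_neq1 a : 0 < a -> 2 ^ a <> 1.
Proof. by move=> a0; have := ltn_expl a (isT : 1 < 2); lia. Qed.

Lemma lim_neq1 e : 3 * 5 ^ e <> 1.
Proof. lia. Qed.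


Local Opaque expn.

(** Transitivity is a constructor of [ltO], so plain inversion need not progress; this form names
    the last step below [c]. *)
Lemma ltO_inv a c : ltO a c ->
  (exists d, [/\ inO d, c = 2 ^ d & a = d \/ ltO a d]) \/
  (exists e n v, [/\ c = 3 * 5 ^ e, phi empty_set e n v & a = v \/ ltO a v]).
Proof.
elim=> [b bO|e n b bO Hb|b d e lt _ _ [[k [kO -> H]]|[k [n [v [-> Hv H]]]]]].
- by left; exists b; split=> //; left.
- by right; exists e, n, b; split=> //; left.
- left; exists k; split=> //; right; case: H => [<-|H] //; exact: ltO_trans H.
- right; exists k, n, v; split=> //; right; case: H => [<-|H] //; exact: ltO_trans H.
Qed.

Lemma not_ltO_1 a : ~ ltO a 1.
Proof.
move=> /ltO_inv[[d [dO E _]]|[e [n [v [E _ _]]]]].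
  exact: (exp2_neq1 (inO_gt0 dO) (esym E)).
exact: (lim_neq1 (esym E)).
Qed.

Lemma ltO_exp2 a b : ltO a (2 ^ b) -> a = b \/ ltO a b.
Proof.
move=> /ltO_inv[[d [dO E]]|[e [n [v [E _ _]]]]]; first by rewrite (exp2_inj E).
by case: (exp2_neq_lim E).
Qed.

Lemma ltO_limit a e : ltO a (3 * 5 ^ e) ->
  exists n v, phi empty_set e n v /\ (a = v \/ ltO a v).
Proof.
move=> /ltO_inv[[d [dO E]]|[e' [n [v [E H1 H2]]]]]; first by case: (exp2_neq_lim (esym E)).
by exists n, v; rewrite (lim_inj E).
Qed.

Definition limP (b : nat) := forall e, b = 3 * 5 ^ e -> exists f : nat -> nat,
  forall n, [/\ phi empty_set e n (f n), inO (f n) & 2 ^ f n = f n.+1 \/ ltO (2 ^ f n) (f n.+1)].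

(** The constructor [ltO_lim] only knows that the limit is a notation, so the mutual induction has
    to carry the properties [limP] of the fundamental sequence along with well-foundedness. *)
Lemma inO_ltO_facts :
  (forall b, inO b -> [/\ inO b, Acc ltO b & limP b]) /\
  (forall a b, ltO a b -> [/\ inO a, inO b, Acc ltO a, Acc ltO b & 2 ^ a = b \/ ltO (2 ^ a) b]).
Proof.
apply: (@inO_ltO_ind (fun b _ => [/\ inO b, Acc ltO b & limP b])
  (fun a b _ => [/\ inO a, inO b, Acc ltO a, Acc ltO b & 2 ^ a = b \/ ltO (2 ^ a) b])).
- split; [exact: O_zero| |by move=> e E; case: (lim_neq1 (esym E))].
  by constructor=> y /not_ltO_1.
- move=> a aO [_ accA _]; split; [exact: O_succ| |by move=> e E; case: (exp2_neq_lim E)].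
  by constructor=> y /ltO_exp2[->//|lt]; exact: (Acc_inv accA lt).
- move=> e f Hset lt IH; split; first exact: O_lim Hset lt.
    constructor=> y /ltO_limit[n [v [Hv]]].
    have [_ _ acc _ _] := IH n; rewrite (phi_det Hv (Hset n)).
    by case=> [->//|lty]; exact: (Acc_inv acc lty).
  by move=> e' E; rewrite -(lim_inj E); exists f => n; have [] := IH n.
- move=> a aO [_ acc _]; split; [done|exact: O_succ|done| |by left].
  by constructor=> y /ltO_exp2[->//|lt]; exact: (Acc_inv acc lt).
- move=> e n a lO [_ acc lim] Ha.
  have lt : ltO a (3 * 5 ^ e) by exact: ltO_lim Ha.
  have [f Hset] := lim e erefl; have [Hn nO Sn] := Hset n; rewrite (phi_det Ha Hn).
  split; [done|done|by rewrite -(phi_det Ha Hn); exact: (Acc_inv acc lt)|done|].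
  have [HSn _ _] := Hset n.+1; have ltS := ltO_lim lO HSn.
  by right; case: Sn => [->|S1]; [exact: ltS | exact: ltO_trans S1 ltS].
- move=> a b c _ [aO bO aA bA H] bc [_ cO _ cA _]; split; [done|done|done|done|].
  by right; case: H => [->|H]; [exact: bc | exact: ltO_trans H bc].
Qed.

Lemma ltO_inOl a b : ltO a b -> inO a. Proof. by case/inO_ltO_facts.2. Qed.
Lemma ltO_inOr a b : ltO a b -> inO b. Proof. by case/inO_ltO_facts.2. Qed.
Lemma inO_Acc b : inO b -> Acc ltO b. Proof. by case/inO_ltO_facts.1. Qed.
Lemma ltO_succ_le a b : ltO a b -> 2 ^ a = b \/ ltO (2 ^ a) b.
Proof. by case/inO_ltO_facts.2. Qed.

Lemma inO_lim e : inO (3 * 5 ^ e) -> exists f : nat -> nat,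
  forall n, [/\ phi empty_set e n (f n), inO (f n), ltO (f n) (3 * 5 ^ e) & ltO (f n) (f n.+1)].
Proof.
move=> lO; have [_ _ lim] := inO_ltO_facts.1 _ lO; have [f Hset] := lim e erefl.
exists f => n; have [H1 H2 H3] := Hset n; split=> //; first exact: ltO_lim H1.
have lt := ltO_succ H2; case: H3 => [<-|H3] //; exact: ltO_trans H3.
Qed.

Lemma ltO_succ_lim a e : ltO a (3 * 5 ^ e) -> ltO (2 ^ a) (3 * 5 ^ e).
Proof. by case/ltO_succ_le => [E|//]; case: (exp2_neq_lim E). Qed.

Lemma inO_induction (Q : nat -> Prop) : Q 1 ->
  (forall a, inO a -> Q a -> Q (2 ^ a)) ->
  (forall e f, inO (3 * 5 ^ e) ->
    (forall n, [/\ phi empty_set e n (f n), inO (f n), ltO (f n) (3 * 5 ^ e) & ltO (f n) (f n.+1)]) ->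
    (forall n, Q (f n)) -> Q (3 * 5 ^ e)) ->
  forall b, inO b -> Q b.
Proof.
move=> Q1 QS Ql b bO; have acc := inO_Acc bO; elim: acc bO => {}b _ IH bO.
move: (bO); move E: {1}b => c cO; case: cO E => [|a aO|e f0 _ _] E; subst b; first exact: Q1.
  by apply: (QS _ aO); apply: (IH _ _ aO); exact: ltO_succ.
have [f Hset] := inO_lim bO; apply: (Ql e f bO Hset) => n.
by have [_ nO lt _] := Hset n; exact: IH.
Qed.

Lemma ltO_1 b : inO b -> b = 1 \/ ltO 1 b.
Proof.
move: b; apply: inO_induction => [|a aO IH|e f lO Hset IH]; first by left.
  right; have lt := ltO_succ aO; case: IH => [E|H]; [by rewrite -{1}E | exact: ltO_trans H lt].
right; have [_ _ lt _] := Hset 0; case: (IH 0) => [E|H]; [by rewrite -{1}E | exact: ltO_trans H lt].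
Qed.

(** * Iterating an operator along a notation *)

Section Iteration.
Variables (base : set_nat) (J : set_nat -> set_nat) (rho : nat -> nat).

(** A relation, because a proof of [inO] cannot be eliminated into data. At a limit, [rho] turns a
    query into the index of a level and a query there: the identity for jumps, [limit_index] for
    forcing questions. *)
Inductive Iter : nat -> set_nat -> Prop :=
| Iter_zero : Iter 1 base
| Iter_succ a Z : inO a -> Iter a Z -> Iter (2 ^ a) (J Z)
| Iter_lim e (f : nat -> nat) (Zs : nat -> set_nat) Y :
    (forall n, phi empty_set e n (f n)) -> (forall n, Iter (f n) (Zs n)) ->
    (forall x, Y x = Zs (cfst (rho x)) (csnd (rho x))) -> Iter (3 * 5 ^ e) Y.

Lemma Iter_ex b : inO b -> exists Y, Iter b Y.
Proof.
move: b; apply: inO_induction => [|a aO [Z HZ]|e f lO Hset IH].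
- by exists base; exact: Iter_zero.
- by exists (J Z); exact: Iter_succ.
- have [Zs HZs] := choice IH.
  exists (fun x => Zs (cfst (rho x)) (csnd (rho x))).
  by apply: (Iter_lim (f := f) _ HZs) => // n; case: (Hset n).
Qed.

Lemma Iter_uniq b : inO b -> forall Y Y', Iter b Y -> Iter b Y' -> Y = Y'.
Proof.
move: b; apply: inO_induction => [|a aO IH|e f lO Hset IH] Y Y'.
- have inv W : Iter 1 W -> W = base.
    move E: 1 => b H; case: H E => [//|c Z cO _ E|e f Zs V _ _ _ E].
      by case: (exp2_neq1 (inO_gt0 cO) (esym E)).
    by case: (lim_neq1 (esym E)).
  by move=> /inv -> /inv ->.
- have inv W : Iter (2 ^ a) W -> exists2 Z, Iter a Z & W = J Z.
    move E: (2 ^ a) => b H; case: H E => [E|c Z _ HZ E|e f Zs V _ _ _ E].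
    + by case: (exp2_neq1 (inO_gt0 aO) E).
    + by exists Z => //; rewrite (exp2_inj E).
    + by case: (exp2_neq_lim E).
  by move=> /inv[Z HZ ->] /inv[Z' HZ' ->]; rewrite (IH _ _ HZ HZ').
- have inv W : Iter (3 * 5 ^ e) W -> exists2 Zs, (forall n, Iter (f n) (Zs n)) &
      W = (fun x => Zs (cfst (rho x)) (csnd (rho x))).
    move E: (3 * 5 ^ e) => b H; case: H E => [E|c Z _ HZ E|e' g Zs V Hg HZs HV E].
    + by case: (lim_neq1 E).
    + by case: (exp2_neq_lim (esym E)).
    have Ee := lim_inj E; subst e'; exists Zs; last exact/funext.
    by move=> n; have [/phi_det /(_ (Hg n)) -> _ _ _] := Hset n.
  move=> /inv[Zs HZs ->] /inv[Zs' HZs' ->]; apply/funext => x.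
  by rewrite (IH _ _ _ (HZs _) (HZs' _)).
Qed.

Definition iterate b : set_nat :=
  if pselect (exists Y, Iter b Y) is left e then projT1 (cid e) else empty_set.

Lemma iterateP b : inO b -> Iter b (iterate b).
Proof.
move=> /Iter_ex H; rewrite /iterate; case: pselect => // e; exact: projT2 (cid e).
Qed.

Lemma iterate1 : iterate 1 = base.
Proof. exact: Iter_uniq O_zero _ _ (iterateP O_zero) Iter_zero. Qed.

Lemma iterateS a : inO a -> iterate (2 ^ a) = J (iterate a).
Proof.
move=> aO; have aO' := O_succ aO.
by apply: (Iter_uniq aO' (iterateP aO')); apply: Iter_succ (iterateP aO).
Qed.

Lemma iterate_lim e v x : inO (3 * 5 ^ e) -> phi empty_set e (cfst (rho x)) v ->
  iterate (3 * 5 ^ e) x = iterate v (csnd (rho x)).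
Proof.
move=> lO Hv; have [f Hset] := inO_lim lO.
have H : Iter (3 * 5 ^ e) (fun x => iterate (f (cfst (rho x))) (csnd (rho x))).
  apply: (Iter_lim (f := f) (Zs := fun n => iterate (f n))) => // n; first by case: (Hset n).
  by apply: iterateP; case: (Hset n).
rewrite (Iter_uniq lO (iterateP lO) H); congr (iterate _ _).
by apply: phi_det Hv; case: (Hset (cfst (rho x))).
Qed.

End Iteration.

(** The H-sets of the hyperarithmetical hierarchy. *)
Definition Hset : nat -> set_nat := iterate empty_set tjump id.

Lemma HsetS a : inO a -> Hset (2 ^ a) = tjump (Hset a).
Proof. exact: iterateS. Qed.

Lemma Hset_lim e n v m : inO (3 * 5 ^ e) -> phi empty_set e n v ->
  Hset (3 * 5 ^ e) (cpair n m) = Hset v m.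
Proof. by move=> lO Hv; rewrite /Hset (@iterate_lim _ _ _ _ v) ?cfstK ?csndK. Qed.

Lemma IJ_Hset b : inO b -> IJ empty_set b (Hset b).
Proof.
move: b; apply: inO_induction => [|a aO IH|e f lO Hset' IH].
- by apply: IJ_zero => n; rewrite /Hset iterate1.
- by rewrite HsetS //; apply: IJ_succ IH (tj_is_jump _).
- apply: (IJ_lim (f := f) _ IH) => [n|n m]; first by case: (Hset' n).
  by apply: Hset_lim => //; case: (Hset' n).
Qed.

Lemma Hset_mono a b : ltO a b -> Tred (Hset a) (Hset b).
Proof.
move=> lt; have bO := ltO_inOr lt; have acc := inO_Acc bO; elim: acc bO a lt => {}b _ IH bO a lt.
case/ltO_inv: (lt) => [[d [dO E H]]|[e [n [v [E Hv H]]]]]; subst b.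
  rewrite HsetS //; case: H => [->|H]; first exact: Tred_tj.
  by apply: Tred_trans (Tred_tj _); apply: IH => //; exact: ltO_succ.
have ltv := ltO_lim bO Hv.
have T : Tred (Hset v) (Hset (3 * 5 ^ e)).
  have -> : Hset v = fun m => Hset (3 * 5 ^ e) (cpair n m).
    by apply/funext => m; rewrite (Hset_lim _ bO Hv).
  by apply: Tred_cf; apply: computable_pair; [exact: computable_const | exact: computable_id].
case: H => [->|H] //; apply: Tred_trans T; apply: IH => //; exact: ltO_inOl ltv.
Qed.

Lemma inO_iter n a : inO a -> inO (iter n (expn 2) a).
Proof. by move=> aO; elim: n => //= n; exact: O_succ. Qed.

(** Finitely many jumps are absorbed into the notation, so being arithmetical in [Hset a] means
    being computable from a level finitely many successors above. *)
Lemma Hset_iter n a : inO a -> Hset (iter n (expn 2) a) = iter n tjump (Hset a).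
Proof. by move=> aO; elim: n => //= n IH; rewrite HsetS ?IH //; exact: inO_iter. Qed.

(** * Definability of the iterates of an arithmetical operator *)

(** Position 0 of a node flags its existence; the elements of its set are shifted by one. *)
Definition present (M : nat -> Prop) c s := M (cpair (cpair c s) 0).
Definition node_set (M : nat -> Prop) c s x := M (cpair (cpair c s) x.+1).

Section Bags.
Variables (base_pred : nat -> Prop) (step_pred : (nat -> Prop) -> nat -> Prop) (rho : nat -> nat).
Hypothesis HB : forall Y, arith Y base_pred.
Hypothesis HJ : forall Y (K : nat -> nat -> Prop), arith Y (fun z => K (cfst z) (csnd z)) ->
  arith Y (fun z => step_pred (K (cfst z)) (csnd z)).
Hypothesis Hrho : computable rho.

Definition iterlevel : nat -> set_nat :=
  iterate (fun x => `[< base_pred x >]) (fun Z x => `[< step_pred (fun y => Z y) x >]) rho.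

(* A bag is a set of labelled nodes [(c, s)], each carrying a set [node_set M c s],
   with local conditions forcing [node_set M c s] to be the [c]-th iterate when [c]
   is a notation. *)
Definition is_bag (M : nat -> Prop) := forall c s, present M c s ->
  (c = 1 -> forall x, node_set M c s x <-> base_pred x) /\
  (forall a, 0 < a -> c = 2 ^ a ->
     exists s', present M a s' /\ forall x, node_set M c s x <-> step_pred (node_set M a s') x) /\
  (forall e, c = 3 * 5 ^ e -> forall n, exists v s', phi empty_set e n v /\ present M v s' /\
     forall x, cfst (rho x) = n -> (node_set M c s x <-> node_set M v s' (csnd (rho x)))).

Lemma bag_uniq M : is_bag M -> forall b, inO b -> forall s, present M b s ->
  forall x, node_set M b s x <-> iterlevel b x.
Proof.
move=> HM; apply: inO_induction => [|a aO IH|e f lO Hset IH] s /HM[H1 [H2 H3]] x.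
- by rewrite (H1 erefl) /iterlevel iterate1; split=> /asboolP.
- have [s' [ps' ->]] := H2 a (inO_gt0 aO) erefl.
  rewrite /iterlevel iterateS //.
  have -> : node_set M a s' = (fun y => iterlevel a y) by apply/funext => y; apply/propext; exact: IH.
  by split=> /asboolP.
- have [v [s' [Hv [ps' H]]]] := H3 e erefl (cfst (rho x)).
  rewrite (H x erefl) /iterlevel (@iterate_lim _ _ _ _ v) //.
  have [Hn _ _ _] := Hset (cfst (rho x)); rewrite (phi_det Hv Hn) in ps' *; exact: IH.
Qed.

Lemma arith_phi0 Y k x v : computable k -> computable x -> computable v -> arith Y (fun z => phi empty_set (k z) (x z) (v z)).
Proof. by move=> *; apply: arith_phi => //; exact: (arith_true Y (is_true false)). Qed.

(** Each clause compares a node with one other node through an arithmetical condition; this is what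
    makes the indices of bags recognizable. *)
Lemma arith_isbag Y (M : nat -> nat -> Prop) : arith Y (fun z => M (cfst z) (csnd z)) ->
  arith Y (fun z => is_bag (M z)).
Proof.
move=> H; rewrite /is_bag /present.
have HBP := HB Y.
pose JJ u x := step_pred (node_set (M (cfst u)) (cfst (csnd u)) (csnd (csnd u))) x.
have HJ' : arith Y (fun z => JJ (cfst z) (csnd z)).
  by apply: (HJ (K := fun u => node_set (M (cfst u)) (cfst (csnd u)) (csnd (csnd u)))); rewrite /node_set; ars.
have HJ2 m a s x : computable m -> computable a -> computable s -> computable x -> arith Y (fun z => step_pred (node_set (M (m z)) (a z) (s z)) (x z)).
  move=> cm ca cs cx.
  have := arith_sub2 HJ' (computable_pair cm (computable_pair ca cs)) cx; apply: arith_ext => z.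
  by rewrite /JJ !(cfstK, csndK).
have HP := arith_phi0 Y.
ars.
all: first [by apply: HJ2; cfs | by apply: HP; cfs | exact: (arith_sub HBP (computable_snd computable_id)) | idtac].
all: by rewrite /node_set; ars.
Qed.

(** Tag 0 keeps the old nodes; tag 1 puts a node labelled [2 ^ a] above each node labelled [a]. *)
Definition bagS a (M : nat -> Prop) z :=
  (cfst (csnd (cfst z)) = 0 /\ M (cpair (cpair (cfst (cfst z)) (csnd (csnd (cfst z)))) (csnd z))) \/
  (cfst (csnd (cfst z)) = 1 /\ cfst (cfst z) = 2 ^ a /\
   M (cpair (cpair a (csnd (csnd (cfst z)))) 0) /\
   (csnd z = 0 \/ exists x, csnd z = x.+1 /\ step_pred (node_set M a (csnd (csnd (cfst z)))) x)).

Lemma present_bagS a M c t s : present (bagS a M) c (cpair t s) <->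
  (t = 0 /\ present M c s) \/ (t = 1 /\ c = 2 ^ a /\ present M a s).
Proof.
rewrite /present /bagS !(cfstK, csndK); split=> [[[-> H]|[-> [-> [H _]]]]|[[-> H]|[-> [-> H]]]];
  by [left|right|left|right; do 3!split=> //; left].
Qed.

Lemma node_set_bagS0 a M c s x : node_set (bagS a M) c (cpair 0 s) x <-> node_set M c s x.
Proof. by rewrite /node_set /bagS !(cfstK, csndK); split=> [[[]|[]]|] //; left. Qed.

Lemma node_set_bagS1 a M s x : present M a s ->
  node_set (bagS a M) (2 ^ a) (cpair 1 s) x <-> step_pred (node_set M a s) x.
Proof.
move=> p; rewrite {1}/node_set /bagS !(cfstK, csndK); split.
  by case=> [[]|[_ [_ [_ [//|[y [[->] ]]]]]]].
by move=> H; right; do 3!split=> //; right; exists x.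
Qed.

Lemma isbag_bagS a M : 0 < a -> is_bag M -> is_bag (bagS a M).
Proof.
move=> a0 HM c s; rewrite -(cunK s); set t := cfst s; set s1 := csnd s.
move: t s1 => t {}s /present_bagS[[-> /HM[H1 [H2 H3]]]|[-> [-> pa]]].
  split=> [E x|]; first by rewrite node_set_bagS0; exact: H1.
  split=> [b b0 E|e E n].
    have [s' [p H]] := H2 b b0 E; exists (cpair 0 s'); split; first by apply/present_bagS; left.
    move=> x; rewrite node_set_bagS0 H.
    suff -> : node_set (bagS a M) b (cpair 0 s') = node_set M b s' by [].
    by apply/funext => y; apply/propext; exact: node_set_bagS0.
  have [v [s' [Hv [p H]]]] := H3 e E n; exists v, (cpair 0 s'); split=> //; split.
    by apply/present_bagS; left.
  by move=> x /H; rewrite !node_set_bagS0.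
split=> [E|]; first by case: (exp2_neq1 a0 E).
split=> [b b0 E|e E]; last by case: (exp2_neq_lim E).
rewrite -(exp2_inj E); exists (cpair 0 s); split; first by apply/present_bagS; left.
move=> x; rewrite node_set_bagS1 //.
suff -> : node_set (bagS a M) a (cpair 0 s) = node_set M a s by [].
by apply/funext => y; apply/propext; exact: node_set_bagS0.
Qed.

Lemma arith_bagS Y a M : arith Y M -> arith Y (bagS a M).
Proof.
move=> H; rewrite /bagS.
pose K u x := node_set M a u x.
have HK : arith Y (fun z => K (cfst z) (csnd z)).
  by rewrite /K /node_set; apply: (arith_sub H); cfs.
have HJK : arith Y (fun z => (fun u x => step_pred (K u) x) (cfst z) (csnd z)) := HJ HK.
have HM f : computable f -> arith Y (fun z => M (f z)) := arith_sub H (f := f).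
ars; try (by apply: HM; cfs).
by apply: (arith_sub2 (F := fun u x => step_pred (K u) x) HJK); cfs.
Qed.

(* Merging all bags enumerable from [Y] avoids choosing their indices uniformly. *)
Definition goodbag (Y : set_nat) p := is_bag (fun x => phi Y p x 1).
Definition bagL (Y : set_nat) e z :=
  (cfst (csnd (cfst z)) = 0 /\ goodbag Y (cfst (csnd (csnd (cfst z)))) /\
   phi Y (cfst (csnd (csnd (cfst z))))
     (cpair (cpair (cfst (cfst z)) (csnd (csnd (csnd (cfst z))))) (csnd z)) 1) \/
  (cfst (csnd (cfst z)) = 1 /\ cfst (cfst z) = 3 * 5 ^ e /\
   (csnd z = 0 \/ exists x p s v, csnd z = x.+1 /\ phi empty_set e (cfst (rho x)) v /\
      goodbag Y p /\ phi Y p (cpair (cpair v s) 0) 1 /\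
      phi Y p (cpair (cpair v s) (csnd (rho x)).+1) 1)).

Lemma present_bagL Y e c t p s : present (bagL Y e) c (cpair t (cpair p s)) <->
  (t = 0 /\ goodbag Y p /\ present (fun x => phi Y p x 1) c s) \/ (t = 1 /\ c = 3 * 5 ^ e).
Proof.
rewrite /present /bagL !(cfstK, csndK); split=> [[[-> H]|[-> [-> _]]]|[[-> H]|[-> ->]]];
  by [left|right|left|right; do 2!split=> //; left].
Qed.

Lemma node_set_bagL0 Y e c p s x : goodbag Y p ->
  node_set (bagL Y e) c (cpair 0 (cpair p s)) x <-> node_set (fun x => phi Y p x 1) c s x.
Proof.
move=> g; rewrite /node_set /bagL !(cfstK, csndK); split; last by left.
by case=> [[_ []]|[]].
Qed.

Lemma node_set_bagL1 Y e u x : node_set (bagL Y e) (3 * 5 ^ e) (cpair 1 u) x <->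
  exists p s v, phi empty_set e (cfst (rho x)) v /\
      goodbag Y p /\ present (fun x => phi Y p x 1) v s /\
      node_set (fun x => phi Y p x 1) v s (csnd (rho x)).
Proof.
rewrite {1}/node_set /bagL !(cfstK, csndK); split.
  by case=> [[]|[_ [_ [//|[y [p [s [v [[->] H]]]]]]]]] //; exists p, s, v.
by move=> [p [s [v H]]]; right; do 2!split=> //; right; exists x, p, s, v.
Qed.

(** Several bags may represent the same level, but [bag_uniq] makes their nodes agree, so the set of
    the new limit node is well defined. *)
Lemma isbag_bagL Y e : inO (3 * 5 ^ e) ->
  (forall n v, phi empty_set e n v -> exists p s, goodbag Y p /\ present (fun x => phi Y p x 1) v s) ->
  is_bag (bagL Y e).
Proof.
move=> lO Hex c s; rewrite -(cunK s) -(cunK (csnd s)); set t := cfst s; set p := cfst _; set s1 := csnd _.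
move: t p s1 => t p {}s /present_bagL[[-> [g /g[H1 [H2 H3]]]]|[-> ->]].
  split=> [E x|]; first by rewrite node_set_bagL0 //; exact: H1.
  split=> [b b0 E|k E n].
    have [s' [pr H]] := H2 b b0 E; exists (cpair 0 (cpair p s')).
    split; first by apply/present_bagL; left.
    move=> x; rewrite node_set_bagL0 // H.
    suff -> : node_set (bagL Y e) b (cpair 0 (cpair p s')) = node_set (fun x => phi Y p x 1) b s' by [].
    by apply/funext => y; apply/propext; exact: node_set_bagL0.
  have [v [s' [Hv [pr H]]]] := H3 k E n; exists v, (cpair 0 (cpair p s')); split=> //; split.
    by apply/present_bagL; left.
  by move=> x /H; rewrite !node_set_bagL0.
split=> [E|]; first by case: (lim_neq1 E).
split=> [b b0 E|k E n]; first by case: (exp2_neq_lim (esym E)).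
rewrite -(lim_inj E); have [f Hset] := inO_lim lO; have [Hn fO _ _] := Hset n.
have [q [s' [g pr]]] := Hex n _ Hn; exists (f n), (cpair 0 (cpair q s')); split=> //.
split; first by apply/present_bagL; left.
move=> x Ex; rewrite node_set_bagL1 node_set_bagL0 //; split.
  move=> [r [u [v]]]; rewrite Ex => -[Hv [g' [pr' K]]].
  rewrite (phi_det Hv Hn) in pr' K.
  by apply/(bag_uniq g fO pr); apply/(bag_uniq g' fO pr').
by move=> K; exists q, s', (f n); rewrite Ex.
Qed.

Lemma arith_bagL Y e : arith Y (bagL Y e).
Proof.
have HY : arith Y (fun z => Y z) by exact: arith_oracle computable_id.
have HP k x v : computable k -> computable x -> computable v -> arith Y (fun z => phi Y (k z) (x z) (v z)).
  by move=> *; exact: arith_phi.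
have HP0 := arith_phi0 Y.
have HG : arith Y (fun z => goodbag Y z).
  by apply: (arith_isbag (M := fun p x => phi Y p x 1)); apply: HP; cfs.
rewrite /bagL; ars; try (by apply: HP; cfs); by apply: HP0; cfs.
Qed.

Lemma bag_ex b : inO b -> exists M, [/\ arith (Hset b) M, is_bag M & exists s, present M b s].
Proof.
move: b; apply: inO_induction => [|a aO [M [HM bM [s ps]]]|e f lO Hlim IH].
- exists (fun z => cfst (cfst z) = 1 /\ (csnd z = 0 \/ exists x, csnd z = x.+1 /\ base_pred x)); split.
  + by have H := HB (Hset 1); ars; exact: (arith_sub H (computable_snd computable_id)).
  + move=> c s; rewrite /present /node_set !(cfstK, csndK) => -[-> _]; split.
      move=> _ x; rewrite !(cfstK, csndK); split=> [[_ [//|[y [[->]]]]]|H] //.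
      by split=> //; right; exists x.
    split=> [a a0 E|e E]; first by case: (exp2_neq1 a0 (esym E)).
    by case: (lim_neq1 (esym E)).
  + by exists 0; rewrite /present !(cfstK, csndK); split=> //; left.
- exists (bagS a M); split; last by exists (cpair 1 s); apply/present_bagS; right.
    by rewrite HsetS //; apply: arith_tj; exact: arith_bagS.
  by apply: isbag_bagS => //; exact: inO_gt0.
- exists (bagL (Hset (3 * 5 ^ e)) e); split.
  + exact: arith_bagL.
  + apply: isbag_bagL => // n v Hv; have [Hn fO lt _] := Hlim n.
    rewrite (phi_det Hv Hn); have [M [[j T] bM [s ps]]] := IH n.
    (* The bag for [f n] costs [j] jumps more than [Hset (f n)], and [j] successors of [f n] stay
       below the limit. *)
    have {}T : Tred (fun x => `[< M x >]) (Hset (3 * 5 ^ e)).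
      apply: Tred_trans T _; rewrite -Hset_iter //; apply: Hset_mono.
      by elim: j => //= j; exact: ltO_succ_lim.
    case: T => p Hp; exists (pickle p), s.
    have E : (fun x => phi (Hset (3 * 5 ^ e)) (pickle p) x 1) = M.
      apply/funext => x; apply/propext; split=> [[q]|Mx].
        rewrite /prog_of pickleK => -[<-] Hq; have := eval_det (Hp x) Hq.
        by case: asboolP.
      exists p; first by rewrite /prog_of pickleK.
      by have := Hp x; rewrite asboolT.
    by rewrite /goodbag E.
  + by exists (cpair 1 (cpair 0 0)); apply/present_bagL; right.
Qed.

Lemma arith_iterlevel b : inO b -> arith (Hset b) (fun x => iterlevel b x).
Proof.
move=> bO; have [M [HM bM [s ps]]] := bag_ex bO.
apply: (@arith_ext _ (node_set M b s)); first exact: bag_uniq.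
by apply: (arith_sub HM); cfs.
Qed.

End Bags.

(** * Large families of open classes *)

(** [d] codes a finite set, the nonzero positions of the string [csnd d] from [cfst d] on. Skipping
    a beginning lets the string be an extension of another one. *)
Definition hits (d : nat) (Y : nat -> Prop) := forall i,
  cfst d <= i -> i < csize (csnd d) -> cnth (csnd d) i <> 0 -> Y i.

Definition meets (W : nat -> nat -> Prop) i (Y : nat -> Prop) := exists d, W i d /\ hits d Y.

(** The finitary form: [n] bounds both the colourings, with colours up to [r], and the witnesses, so
    no quantifier over sets occurs. *)
Definition Large (W : nat -> nat -> Prop) := forall N r, exists n, forall c,
  csize c = n -> (forall i, i < n -> cnth c i <= r) ->
  exists q, q <= r /\ forall i, i < N -> exists d, W i d /\ csize (csnd d) <= n /\
    forall k, cfst d <= k -> k < csize (csnd d) -> cnth (csnd d) k <> 0 -> cnth c k = q.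

Definition LargeS (W : nat -> nat -> Prop) (X : nat -> Prop) :=
  forall N r (chi : nat -> nat), (forall i, chi i <= r) ->
  exists q, q <= r /\ forall i, i < N -> meets W i (fun k => X k /\ chi k = q).

Lemma hits_mono d (Y Y' : nat -> Prop) : (forall i, Y i -> Y' i) -> hits d Y -> hits d Y'.
Proof. by move=> sub H i h1 h2 h3; apply: sub; exact: H. Qed.

Lemma meets_mono W i (Y Y' : nat -> Prop) : (forall i, Y i -> Y' i) -> meets W i Y -> meets W i Y'.
Proof. by move=> sub [d [Wd H]]; exists d; split=> //; exact: hits_mono sub H. Qed.

Lemma LargeS_mono W (X X' : nat -> Prop) : (forall i, X i -> X' i) -> LargeS W X -> LargeS W X'.
Proof.
move=> sub H N r chi b; have [q [le Hq]] := H N r chi b; exists q; split=> // i /Hq.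
by apply: meets_mono => k [/sub].
Qed.

Lemma bounded_choice (Q : nat -> nat -> Prop) N :
  (forall i m m', m <= m' -> Q i m -> Q i m') ->
  (forall i, i < N -> exists m, Q i m) -> exists m, forall i, i < N -> Q i m.
Proof.
move=> mono; elim: N => [|N IH] H; first by exists 0.
have [i lt|m Hm] := IH; first by apply: H; lia.
have [m' Hm'] := H N (leqnn _); exists (maxn m m') => i.
rewrite ltnS leq_eqVlt => /orP[/eqP->|/Hm Hi].
  by apply: mono Hm'; lia.
by apply: mono Hi; lia.
Qed.

Lemma koenig (B : nat -> (nat -> nat) -> Prop) r :
  (forall n c c', (forall i, i < n -> c i = c' i) -> B n c -> B n c') ->
  (forall n n' c, n <= n' -> B n' c -> B n c) ->
  (forall n, exists c, (forall i, c i <= r) /\ B n c) ->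
  exists c, (forall i, c i <= r) /\ forall n, B n c.
Proof.
move=> loc anti ex.
(* The nodes of the tree that extend to every level; the branch stays among them. *)
pose T k (s : nat -> nat) := forall n, exists c, [/\ forall i, c i <= r, B n c & forall i, i < k -> c i = s i].
have T0 s : T 0 s by move=> n; have [c [b Bc]] := ex n; exists c.
have step k s : exists q, T k s -> q <= r /\ T k.+1 (fun i => if i == k then q else s i).
  have [Ts|nT] := pselect (T k s); last by exists 0.
  apply: contrapT => H.
  (* If every next value failed, a level beyond all these bounds of failure would contradict the
     extendibility of [s]. *)
  have {}H : forall q, q < r.+1 -> exists n, forall n', n <= n' ->
      ~ exists c, [/\ forall i, c i <= r, B n' c & forall i, i < k.+1 -> c i = if i == k then q else s i].
    move=> q lt; apply: contrapT => H'; apply: H; exists q => _; split=> // n.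
    apply: contrapT => Hn; apply: H'; exists n => n' le [c [b Bc e]]; apply: Hn.
    by exists c; split=> //; exact: anti Bc.
  have [|m Hm] := bounded_choice _ H.
    by move=> i m m' le H' n' le'; apply: H'; exact: leq_trans le'.
  have [c [b Bc e]] := Ts m.
  apply: (Hm (c k) _ m) => //; first by rewrite ltnS.
  exists c; split=> // i; rewrite ltnS leq_eqVlt; case: eqP => [->|ne] //= lt.
  exact: e.
have [F HF] : {F : nat -> (nat -> nat) -> nat & forall k s, T k s ->
    F k s <= r /\ T k.+1 (fun i => if i == k then F k s else s i)}.
  have [F HF] := choice (fun ks : nat * (nat -> nat) => step ks.1 ks.2).
  by exists (fun k s => F (k, s)) => k s; exact: (HF (k, s)).
pose S := fix S k := if k is k'.+1 then fun i => if i == k' then F k' (S k') else S k' i else fun _ => 0.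
have TS k : T k (S k) by elim: k => [|k IH] //=; exact: (HF k _ IH).2.
pose chi k := F k (S k).
have SE k i : i < k -> S k i = chi i.
  elim: k => //= k IH; rewrite ltnS leq_eqVlt; case: eqP => [->|ne] //=; exact: IH.
exists chi; split=> [i|n]; first exact: (HF i _ (TS i)).1.
have [c [b Bc e]] := TS n n; apply: loc Bc => i lt; by rewrite e // SE.
Qed.

(** Compactness: if every [n] had a bad colouring, [koenig] would give one colouring bad for all
    [n], while a good colour for it needs only finitely many finite witnesses. *)
Lemma LargeP W : Large W <-> LargeS W (fun _ => True).
Proof.
split=> [H N r chi b|H N r].
  have [n Hn] := H N r; have [c [sc nc]] := cseqP chi n.
  have [||q [le Hq]] := Hn c => // [i lt|]; first by rewrite nc.
  exists q; split=> // i /Hq[d [Wd [sd Hd]]]; exists d; split=> // k k1 k2 k3; split=> //.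
  by rewrite -(Hd k k1 k2 k3) nc //; lia.
apply: contrapT => no.
pose B n (c : nat -> nat) := forall q, q <= r -> ~ forall i, i < N -> exists d, W i d /\ csize (csnd d) <= n /\
    forall k, cfst d <= k -> k < csize (csnd d) -> cnth (csnd d) k <> 0 -> c k = q.
have [n c c' E Bc q le H'|n n' c le Bc q lq H'|n|chi [b Bchi]] := @koenig B r.
- apply: (Bc q le) => i /H'[d [Wd [sd Hd]]]; exists d; split=> //; split=> // k k1 k2 k3.
  by rewrite E ?Hd //; lia.
- apply: (Bc q lq) => i /H'[d [Wd [sd Hd]]]; exists d; split=> //; split=> //; lia.
- apply: contrapT => Hn; apply: no; exists n => c sc bc; apply: contrapT => Hc; apply: Hn.
  exists (fun i => if i < n then cnth c i else 0); split=> [i|q le H'].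
    by case: ltnP => // /bc.
  apply: Hc; exists q; split=> // i /H'[d [Wd [sd Hd]]]; exists d; split=> //; split=> // k k1 k2 k3.
  by have := Hd k k1 k2 k3; rewrite (_ : k < n) //; lia.
have [q [le Hq]] := H N r chi b.
have [|i /Hq[d [Wd Hd]]|m Hm] := @bounded_choice (fun i m => exists d, W i d /\ csize (csnd d) <= m /\
    forall k, cfst d <= k -> k < csize (csnd d) -> cnth (csnd d) k <> 0 -> chi k = q) N.
- by move=> i m m' lm [d [Wd [sd Hd]]]; exists d; split=> //; split=> //; lia.
- exists (csize (csnd d)), d; split=> //; split=> // k k1 k2 k3; exact: (Hd k k1 k2 k3).2.
exact: (Bchi m q le).
Qed.

Lemma LargeS_split W (X P : nat -> Prop) : LargeS W X ->
  LargeS W (fun i => X i /\ P i) \/ LargeS W (fun i => X i /\ ~ P i).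
Proof.
move=> H; apply: contrapT => /not_orP[].
move=> /existsNP[N0 /existsNP[r0 /existsNP[c0 /not_implyP[b0 H0]]]].
move=> /existsNP[N1 /existsNP[r1 /existsNP[c1 /not_implyP[b1 H1]]]].
(* The colourings spoiling the two halves get disjoint palettes, up to [r0] on [P] and from [r0.+1]
   off it, so a good colour for [chi] serves one of the halves. *)
pose chi i := if pselect (P i) then c0 i else (r0 + c1 i).+1.
have [i|q [le Hq]] := H (maxn N0 N1) (r0 + r1).+1 chi.
  by rewrite /chi; case: pselect => ? /=; [have := b0 i | have := b1 i]; lia.
have [l0|l1] : q <= r0 \/ r0 < q by lia.
  apply: H0; exists q; split=> // i lt.
  have : i < maxn N0 N1 by lia.
  move=> /Hq; apply: meets_mono => k [Xk]; rewrite /chi; case: pselect => Pk /=; [by []|lia].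
apply: H1; exists (q - r0.+1); split=> [|i lt]; first lia.
have : i < maxn N0 N1 by lia.
move=> /Hq; apply: meets_mono => k [Xk]; rewrite /chi; case: pselect => Pk /= E.
  by have := b0 k; lia.
by split=> //; lia.
Qed.

(** * The hierarchy of forcing questions *)

(* Level data [K] codes [answers K E s j]: the string [E] answers "yes" to the literal
   "[j] is in the iterated jump" (negated if [s = 0]), and [in_base K n d]: [d] is in
   the base of the [n]-th accepted class. *)
Definition answers (K : nat -> Prop) E s j := K (cpair 0 (cpair E (cpair s j))).
Definition in_base (K : nat -> Prop) n d := K (cpair 1 (cpair n d)).

Definition halts_on k s := (forall j, j < csize s -> cnth s j <= 1) /\ exists v, phiC s k k v.

Definition yes_to K E k := exists s, halts_on k s /\ forall j, j < csize s -> answers K E (cnth s j) j.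

(** [m] codes a pair [(E, k)], and the string of [d] is an extension of [E]; the marker [cfst d]
    makes [hits] ask for its new elements only. *)
Definition in_base_of K m d := cfst d = csize (cfst m) /\ csize (cfst m) <= csize (csnd d) /\
  (forall i, i < csize (cfst m) -> cnth (csnd d) i = cnth (cfst m) i) /\
  yes_to K (csnd d) (csnd m).

(** An index outside [S] gets the full base, hence a class of all sets, which imposes nothing. *)
Definition family K (S : nat -> Prop) n d :=
  (cfst n = 0 /\ in_base K (csnd n) d) \/ (cfst n <> 0 /\ (S (csnd n) -> in_base_of K (csnd n) d)).

(* Greedy choice: [s] lists the decisions taken on the indices up to [m]. *)
Definition accepted K m := exists s, (forall i, i <= m -> (cnth s i <> 0 <->
    Large (family K (fun j => (j < i /\ cnth s j <> 0) \/ j = i)))) /\ cnth s m <> 0.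

(** The two kinds of answer are not complementary: while [(E, k)] is accepted but no computation has
    converged, [E] gives neither. *)
Definition next_level K x :=
  (cfst x = 0 /\
    ((cfst (csnd (csnd x)) <> 0 /\ yes_to K (cfst (csnd x)) (csnd (csnd (csnd x)))) \/
     (cfst (csnd (csnd x)) = 0 /\ ~ accepted K (cpair (cfst (csnd x)) (csnd (csnd (csnd x))))))) \/
  (cfst x <> 0 /\ family K (accepted K) (cfst (csnd x)) (csnd (csnd x))).

Definition literal1 E s j := j < csize E /\ (s <> 0 <-> cnth E j <> 0).
(** The bottom classes consist of the sets with an element at least [n], so that largeness entails
    infinitude. *)
Definition tail1 n d := n <= cfst d /\ exists i, cfst d <= i /\ i < csize (csnd d) /\ cnth (csnd d) i <> 0.

Definition base_level x :=
  (cfst x = 0 /\ literal1 (cfst (csnd x)) (cfst (csnd (csnd x))) (csnd (csnd (csnd x)))) \/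
  (cfst x <> 0 /\ tail1 (cfst (csnd x)) (csnd (csnd x))).

(** Pulls the level index out of the literal [cpair n m], or out of the class index [cpair n m], to
    the front of the query. *)
Definition limit_index x :=
  if cfst x is _.+1 then
    cpair (cfst (cfst (csnd x))) (cpair 1 (cpair (csnd (cfst (csnd x))) (csnd (csnd x))))
  else cpair (cfst (csnd (csnd (csnd x))))
    (cpair 0 (cpair (cfst (csnd x)) (cpair (cfst (csnd (csnd x))) (csnd (csnd (csnd (csnd x))))))).

Lemma computable_rhof : computable limit_index.
Proof. by apply: computable_if; cfs. Qed.

Lemma arith_BPf Y : arith Y base_level.
Proof. by rewrite /base_level /literal1 /tail1; ars. Qed.

Lemma arith_JPf Y (K : nat -> nat -> Prop) : arith Y (fun z => K (cfst z) (csnd z)) ->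
  arith Y (fun z => next_level (K (cfst z)) (csnd z)).
Proof.
move=> H; have HC := @arith_phiC Y.
have HT : arith Y (fun z => halts_on (cfst z) (csnd z)) by rewrite /halts_on; ars; apply: HC; cfs.
by rewrite /next_level /family /accepted /Large /family /in_base_of /yes_to /answers /in_base; ars.
Qed.

Definition level b x : Prop := iterlevel base_level next_level limit_index b x.

Lemma arith_level b : inO b -> arith (Hset b) (level b).
Proof. by apply: arith_iterlevel; [exact: arith_BPf | exact: arith_JPf | exact: computable_rhof]. Qed.

Lemma level1 : level 1 = base_level.
Proof. by apply/funext => x; rewrite /level /iterlevel iterate1; exact: asboolE. Qed.

Lemma levelS a : inO a -> level (2 ^ a) = next_level (level a).
Proof. by move=> aO; apply/funext => x; rewrite /level /iterlevel iterateS //; exact: asboolE. Qed.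

Lemma level_lim e v x : inO (3 * 5 ^ e) -> phi empty_set e (cfst (limit_index x)) v ->
  level (3 * 5 ^ e) x = level v (csnd (limit_index x)).
Proof. by move=> lO Hv; rewrite /level /iterlevel (@iterate_lim _ _ _ _ v). Qed.

Lemma answers1 E s j : answers (level 1) E s j <-> literal1 E s j.
Proof.
rewrite /answers level1 /base_level !(cfstK, csndK); split=> [[[]|[]]|] //; by left.
Qed.

Lemma in_base1 n d : in_base (level 1) n d <-> tail1 n d.
Proof.
rewrite /in_base level1 /base_level !(cfstK, csndK); split=> [[[]|[]]|] //; by right.
Qed.

Lemma answersS a E s k : inO a -> answers (level (2 ^ a)) E s k <->
  (s <> 0 /\ yes_to (level a) E k) \/ (s = 0 /\ ~ accepted (level a) (cpair E k)).
Proof.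
move=> aO; rewrite /answers levelS // /next_level !(cfstK, csndK); split=> [[[]|[]]|] //; by left.
Qed.

Lemma in_baseS a n d : inO a -> in_base (level (2 ^ a)) n d <-> family (level a) (accepted (level a)) n d.
Proof.
move=> aO; rewrite /in_base levelS // /next_level !(cfstK, csndK); split=> [[[]|[]]|] //; by right.
Qed.

Lemma answers_lim e n v E s m : inO (3 * 5 ^ e) -> phi empty_set e n v ->
  answers (level (3 * 5 ^ e)) E s (cpair n m) = answers (level v) E s m.
Proof.
by move=> lO Hv; rewrite /answers (@level_lim _ v) // /limit_index !(cfstK, csndK).
Qed.

Lemma in_base_lim e n v m d : inO (3 * 5 ^ e) -> phi empty_set e n v ->
  in_base (level (3 * 5 ^ e)) (cpair n m) d = in_base (level v) m d.
Proof.
by move=> lO Hv; rewrite /in_base (@level_lim _ v) // /limit_index !(cfstK, csndK).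
Qed.

Lemma leq_cpairl a b : a <= cpair a b.
Proof.
rewrite /cpair; case: a => // a.
have : (a.+1 + b).*2 <= (a.+1 + b) * (a.+1 + b).+1 by rewrite -muln2; apply: leq_mul; lia.
by move=> /half_leq; rewrite doubleK; lia.
Qed.

Lemma family_ext K (S S' : nat -> Prop) : (forall i, S i <-> S' i) -> family K S = family K S'.
Proof. by move=> E; have -> : S = S' by apply/funext => i; apply/propext. Qed.

Definition stage K m j := (j < m /\ accepted K j) \/ j = m.

(** The clause for [i] consults only earlier decisions, so all traces agree. *)
Lemma accepted_trace K m s : (forall i, i <= m -> (cnth s i <> 0 <->
    Large (family K (fun j => (j < i /\ cnth s j <> 0) \/ j = i)))) ->
  forall i, i <= m -> (cnth s i <> 0 <-> accepted K i).
Proof.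
move=> H i le; split=> [ne|[s' [H' ne']]].
  by exists s; split=> // k lk; apply: H; lia.
suff E k : k <= i -> (cnth s k <> 0 <-> cnth s' k <> 0) by apply/E.
elim/ltn_ind: k => k IH lk; rewrite H ?H' //; last lia.
rewrite (family_ext _ (S' := fun j => (j < k /\ cnth s' j <> 0) \/ j = k)) // => j.
split=> [[[lt h]|->]|[[lt h]|->]]; try (by right); left; split=> //; apply/(IH j) => //; lia.
Qed.

Lemma accepted_ex_trace K m : exists s, forall i, i <= m -> (cnth s i <> 0 <->
    Large (family K (fun j => (j < i /\ cnth s j <> 0) \/ j = i))).
Proof.
suff [g Hg] : exists g : nat -> nat, forall i, i <= m -> (g i <> 0 <->
    Large (family K (fun j => (j < i /\ g j <> 0) \/ j = i))).
  have [s [_ Es]] := cseqP g m.+1; exists s => i le; rewrite Es // Hg //.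
  rewrite (family_ext _ (S' := fun j => (j < i /\ cnth s j <> 0) \/ j = i)) // => j.
  by split=> [[[lt h]|->]|[[lt h]|->]]; try (by right); left; split=> //; move: h; rewrite Es //; lia.
elim: m => [|m [g Hg]].
  pose g (_ : nat) : nat := `[< Large (family K (fun j => j = 0)) >].
  exists g => -[|//] _; rewrite (family_ext _ (S' := fun j => j = 0)).
    by rewrite /g; case: asboolP.
  by move=> j; split=> [[[]|]|] //; right.
pose v : nat := `[< Large (family K (fun j => (j < m.+1 /\ g j <> 0) \/ j = m.+1)) >].
pose g' i := if i == m.+1 then v else g i.
have E i k : i <= m.+1 -> k < i -> g' k = g k by rewrite /g'; case: eqP => // ->; lia.
exists g' => i le.
have -> : family K (fun j => (j < i /\ g' j <> 0) \/ j = i) = family K (fun j => (j < i /\ g j <> 0) \/ j = i).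
  apply: family_ext => j.
  by split=> [[[lt h]|->]|[[lt h]|->]]; try (by right); left; split=> //; move: h; rewrite (E i).
rewrite {1}/g'; case: eqP => [->|ne]; last by apply: Hg; lia.
by rewrite /v; case: asboolP.
Qed.

Lemma acceptedE K m : accepted K m <-> Large (family K (stage K m)).
Proof.
have [s Hs] := accepted_ex_trace K m; rewrite -(accepted_trace Hs (leqnn m)) Hs //.
rewrite (family_ext _ (S' := stage K m)) // => j; rewrite /stage.
split=> [[[lt h]|->]|[[lt h]|->]]; try (by right); left; split=> //; move: h;
  by rewrite (accepted_trace Hs) //; lia.
Qed.

Lemma LargeS_sub W W' X : (forall N, exists N', forall i, i < N -> exists2 j, j < N' &
    forall d, W' j d -> W i d) -> LargeS W' X -> LargeS W X.
Proof.
move=> sub H N r chi b; have [N' HN] := sub N; have [q [le Hq]] := H N' r chi b.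
exists q; split=> // i /HN[j /Hq[d [Wd Hd]] imp]; exists d; split=> //; exact: imp.
Qed.

(** Every finite stage stays large by the greedy choice, and largeness concerns only finitely many
    classes at a time. *)
Lemma Large_accepted K : LargeS (in_base K) (fun _ => True) ->
  LargeS (family K (accepted K)) (fun _ => True).
Proof.
move=> H.
have stage m : LargeS (family K (fun j => j < m /\ accepted K j)) (fun _ => True).
  elim: m => [|m IH].
    apply: LargeS_sub H => N; exists N.+1 => i lt.
    have [E|ne] := eqVneq (cfst i) 0.
      exists (csnd i); last by move=> d Hd; left.
      by have := leq_cpairr (cfst i) (csnd i); rewrite cunK; lia.
    by exists 0 => // d _; right; split; [exact/eqP | case].
  have [Am|nA] := pselect (accepted K m).
    move/acceptedE/LargeP: (Am); rewrite (family_ext _ (S' := fun j => j < m.+1 /\ accepted K j)) // => j.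
    rewrite /stage; split=> [[[lt h]|->]|[lt h]]; first by split=> //; lia.
      by split.
    by have [->|ne] := eqVneq j m; [right | left; split=> //; lia].
  rewrite (family_ext _ (S' := fun j => j < m /\ accepted K j)) // => j.
  split=> [[lt h]|[lt h]]; split=> //; last lia.
  by have [E|ne] := eqVneq j m; [case: nA; rewrite -E | lia].
move=> N r chi b; have [q [le Hq]] := stage N N r chi b; exists q; split=> // i lt.
have [d [[[E V]|[ne U]] h]] := Hq i lt; exists d; split=> //; first by left.
(* The class with index [i] concerns the pair [csnd i <= i < N], already treated at stage [N]. *)
right; split=> // A; apply: U; split=> //.
by have := leq_cpairr (cfst i) (csnd i); rewrite cunK; lia.
Qed.

Definition large_at b (X : nat -> Prop) := LargeS (in_base (level b)) X.

(** Old classes survive under tag 0 at successors and under the index of their level at limits, so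
    higher levels demand more of a set. *)
Lemma in_base_cumul a b : ltO a b -> forall n, exists n', forall d, in_base (level b) n' d -> in_base (level a) n d.
Proof.
move=> lt; have bO := ltO_inOr lt; have acc := inO_Acc bO; elim: acc bO a lt => {}b _ IH bO a lt n.
case/ltO_inv: (lt) => [[d [dO E H]]|[e [k [v [E Hv H]]]]]; subst b.
  have base m : exists n', forall d', in_base (level (2 ^ d)) n' d' -> in_base (level d) m d'.
    exists (cpair 0 m) => d' /(in_baseS _ _ dO); rewrite /family cfstK csndK.
    by case=> [[_]|[]].
  case: H => [->|H]; first exact: base.
  have [m Hm] := IH d (ltO_succ dO) dO a H n; have [n' Hn'] := base m.
  by exists n' => d' /Hn' /Hm.
have base m : exists n', forall d', in_base (level (3 * 5 ^ e)) n' d' -> in_base (level v) m d'.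
  by exists (cpair k m) => d'; rewrite (in_base_lim _ _ bO Hv).
case: H => [->|H]; first exact: base.
have ltv := ltO_lim bO Hv.
have [m Hm] := IH v ltv (ltO_inOl ltv) a H n; have [n' Hn'] := base m.
by exists n' => d' /Hn' /Hm.
Qed.

Lemma large_at_anti a b X : ltO a b -> large_at b X -> large_at a X.
Proof.
move=> lt; apply: LargeS_sub => N.
have [|i _|m Hm] := @bounded_choice (fun i m => exists2 j, j < m & forall d, in_base (level b) j d -> in_base (level a) i d) N.
- by move=> i m m' le [j lj Hj]; exists j => //; lia.
- by have [n' H] := in_base_cumul lt i; exists n'.+1, n'.
by exists m.
Qed.

Lemma pigeonhole_large r (chi : nat -> nat) n : (forall i, chi i <= r) ->
  exists2 q, q <= r & forall m, m <= n -> exists2 i, m <= i & chi i = q.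
Proof.
move=> b; apply: contrapT => H.
have {}H q : q < r.+1 -> exists m, forall i, m <= i -> chi i <> q.
  move=> lt; apply: contrapT => H'; apply: H; exists q => // m _.
  by apply: contrapT => Hm; apply: H'; exists m => i le E; apply: Hm; exists i.
have [|m Hm] := bounded_choice _ H.
  by move=> i m m' le Hm k lk; apply: Hm; lia.
by apply: (Hm (chi m) _ m) => //; rewrite ltnS.
Qed.

Lemma large_at_top b : inO b -> large_at b (fun _ => True).
Proof.
move: b; apply: inO_induction => [|a aO IH|e f lO Hlim IH].
- move=> N r chi b; have [q le Hq] := pigeonhole_large N b; exists q; split=> // n lt.
  have [i li Ei] := Hq n (ltnW lt).
  have [c [sc nc]] := cseqP (fun k => (k == i) : nat) i.+1; exists (cpair n c); split.
    apply/in_base1; rewrite /tail1 cfstK csndK; split=> //; exists i; rewrite sc nc //.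
    by rewrite eqxx.
  move=> k; rewrite cfstK csndK sc => _ lk; rewrite nc // => ne; split=> //.
  by move: ne; case: eqP => // ->.
- rewrite /large_at (_ : in_base (level (2 ^ a)) = family (level a) (accepted (level a))); first exact: Large_accepted.
  by apply/funext => n; apply/funext => d; apply/propext; exact: in_baseS.
- move=> N; suff : exists2 v, large_at v (fun _ => True) & exists N', forall i, i < N ->
      exists2 j, j < N' & forall d, in_base (level v) j d -> in_base (level (3 * 5 ^ e)) i d.
    move=> [v Hv [N' HN]] r chi b; have [q [le Hq]] := Hv N' r chi b.
    exists q; split=> // i /HN[j /Hq[d [Wd Hd]] imp]; exists d; split=> //; exact: imp.
  (* An index [i < N] refers to the level [f (cfst i)] with [cfst i <= i], so these finitely many
     classes all recur at level [f N]. *)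
  exists (f N) => //; apply: bounded_choice => [i m m' le [j lj Hj]|i lt].
    by exists j => //; lia.
  have Fi : cfst i < N by have := leq_cpairl (cfst i) (csnd i); rewrite cunK; lia.
  have chain k : ltO (f (cfst i)) (f (cfst i + k.+1)).
    elim: k => [|k IHk]; first by rewrite addn1; case: (Hlim (cfst i)).
    by apply: ltO_trans IHk _; rewrite !addnS; case: (Hlim (cfst i + k).+1).
  have {}chain : ltO (f (cfst i)) (f N).
    by have := chain (N - (cfst i).+1); have -> : cfst i + (N - (cfst i).+1).+1 = N by lia.
  have [n' Hn'] := in_base_cumul chain (csnd i); exists n'.+1, n' => // d /Hn'.
  by have [Hn _ _ _] := Hlim (cfst i); rewrite -(in_base_lim _ _ lO Hn) cunK.
Qed.

Lemma meets_of_large_at b X n : large_at b X -> meets (in_base (level b)) n X.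
Proof.
move=> H; have [q [_ Hq]] := H n.+1 0 (fun _ => 0) (fun _ => leqnn 0).
by apply: meets_mono (Hq n (leqnn _)) => k [].
Qed.

(** * Forcing *)

Section Forcing.
(** [Bl] abstracts the notations below the limit ordinal. *)
Variable Bl : nat -> Prop.
Hypothesis Bl1 : Bl 1.
Hypothesis BlO : forall b, Bl b -> inO b.
Hypothesis Bl_down : forall a b, Bl b -> ltO a b -> Bl a.
Hypothesis Bl_lin : forall a b, Bl a -> Bl b -> [\/ a = b, ltO a b | ltO b a].
Hypothesis Bl_succ : forall b, Bl b -> Bl (2 ^ b).

Definition large_below X := forall b, Bl b -> large_at b X.

Lemma large_below_mono (X X' : nat -> Prop) : (forall i, X i -> X' i) -> large_below X -> large_below X'.
Proof. by move=> sub H b /H; exact: LargeS_mono. Qed.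

(** Levels at which the two halves fail are comparable, and at the higher one both would fail,
    against [LargeS_split]. *)
Lemma large_below_split (X P : nat -> Prop) : large_below X ->
  large_below (fun i => X i /\ P i) \/ large_below (fun i => X i /\ ~ P i).
Proof.
move=> H; apply: contrapT => /not_orP[/existsNP[a /not_implyP[Ba Ha]] /existsNP[b /not_implyP[Bb Hb]]].
have [c [Bc Hac Hbc]] : exists c, [/\ Bl c, forall X, large_at c X -> large_at a X & forall X, large_at c X -> large_at b X].
  case: (Bl_lin Ba Bb) => [E|lt|lt].
  - by exists a; split=> //; rewrite -E.
  - by exists b; split=> // Y; exact: large_at_anti.
  - by exists a; split=> // Y; exact: large_at_anti.
by case: (LargeS_split P (H c Bc)) => [/Hac|/Hbc].
Qed.

Lemma large_below_color r (chi : nat -> nat) (X : nat -> Prop) : (forall i, chi i <= r) -> large_below X ->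
  exists2 q, q <= r & large_below (fun i => X i /\ chi i = q).
Proof.
elim: r chi X => [|r IH] chi X b HX.
  exists 0 => //; apply: large_below_mono HX => i Xi; split=> //; have := b i; lia.
have [H|H] := large_below_split (fun i => chi i = r.+1) HX; first by exists r.+1.
(* Colours [r] and [r.+1] are merged, as the latter is absent from this part. *)
have [i|q le Hq] := IH (fun i => minn (chi i) r) _ _ H; first lia.
exists q; first lia.
by apply: large_below_mono Hq => i [[Xi ne] E]; split=> //; have := b i; lia.
Qed.

Definition string_ext E E' := csize E <= csize E' /\ forall i, i < csize E -> cnth E' i = cnth E i.
Definition newin E E' (X : nat -> Prop) := forall i, csize E <= i -> i < csize E' -> cnth E' i <> 0 -> X i.

(** The string [E] is a finite part of the generic set and the reservoir [X] restricts its later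
    elements. A negative literal is forced by a reservoir outside the class of [(E, k)]: no
    extension inside [X] answers yes. *)
Inductive forces : nat -> nat -> (nat -> Prop) -> nat -> nat -> Prop :=
| forces_zero E X s j : literal1 E s j -> forces 1 E X s j
| forces_pos a E X s k t : inO a -> s <> 0 -> halts_on k t ->
    (forall j, j < csize t -> forces a E X (cnth t j) j) -> forces (2 ^ a) E X s k
| forces_neg a E X k : inO a -> ~ (exists d, in_base_of (level a) (cpair E k) d /\ hits d X) ->
    forces (2 ^ a) E X 0 k
| forces_lim e n v E X s m : phi empty_set e n v -> forces v E X s m ->
    forces (3 * 5 ^ e) E X s (cpair n m).

Lemma forces_inv1 E X s j : forces 1 E X s j -> literal1 E s j.
Proof.
move Eb: 1 => b H; case: H Eb => // [a E' X' s' k t aO _ _ _|a E' X' k aO _|e n v E' X' s' m _ _] Eb.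
- by case: (exp2_neq1 (inO_gt0 aO) (esym Eb)).
- by case: (exp2_neq1 (inO_gt0 aO) (esym Eb)).
- by case: (lim_neq1 (esym Eb)).
Qed.

Lemma forces_inv2 a E X s k : inO a -> forces (2 ^ a) E X s k ->
  (s <> 0 /\ exists t, halts_on k t /\ forall j, j < csize t -> forces a E X (cnth t j) j) \/
  (s = 0 /\ ~ (exists d, in_base_of (level a) (cpair E k) d /\ hits d X)).
Proof.
move=> aO; move Eb: (2 ^ a) => b H; case: H Eb => [E' X' s' j _|c E' X' s' k' t cO s0 T H|c E' X' k' cO H|e n v E' X' s' m _ _] Eb.
- by case: (exp2_neq1 (inO_gt0 aO) Eb).
- by left; split=> //; exists t; rewrite (exp2_inj Eb).
- by right; rewrite (exp2_inj Eb).
- by case: (exp2_neq_lim Eb).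
Qed.

Lemma forces_inv3 e n v E X s m : phi empty_set e n v -> forces (3 * 5 ^ e) E X s (cpair n m) -> forces v E X s m.
Proof.
move=> Hv; move Eb: (3 * 5 ^ e) => b; move Ej: (cpair n m) => j H.
case: H Eb Ej => [E' X' s' j' _|c E' X' s' k' t cO s0 T H|c E' X' k' cO H|e' n' v' E' X' s' m' Hv' H] Eb Ej.
- by case: (lim_neq1 Eb).
- by case: (exp2_neq_lim (esym Eb)).
- by case: (exp2_neq_lim (esym Eb)).
- case: (cpair_inj Ej) => ? ?; subst n' m'; have Ee := lim_inj Eb; subst e'.
  by rewrite (phi_det Hv Hv').
Qed.

Lemma forces_persist b E X s j : forces b E X s j -> forall E' (X' : nat -> Prop), string_ext E E' -> newin E E' X ->
  (forall i, X' i -> X i) -> forces b E' X' s j.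
Proof.
elim=> {b E X s j} [E X s j [lt H]|a E X s k t aO s0 T _ IH|a E X k aO H|e n v E X s m Hv _ IH] E' X' [le ex] nw sub.
- by apply: forces_zero; split; [lia | rewrite ex].
- by apply: (forces_pos aO s0 T) => j lt; apply: IH.
- apply: (forces_neg aO) => -[d [[h1 [h2 [h3 h4]]] hd]]; apply: H; rewrite !(cfstK, csndK) in h1 h2 h3 h4.
  (* A witness above [E'] is one above [E] once its marker moves down to [csize E]: its further
     elements are new in [E'], hence in [X], or lie in [X']. *)
  exists (cpair (csize E) (csnd d)); split.
    rewrite /in_base_of !(cfstK, csndK); split=> //; split; first lia.
    by split=> // i lt; rewrite h3 ?ex //; lia.
  move=> i; rewrite !(cfstK, csndK) => li lt ne.
  have [l|l] : i < csize E' \/ csize E' <= i by lia.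
    by apply: nw => //; rewrite -h3.
  by apply: sub; apply: hd => //; rewrite h1.
- by apply: forces_lim Hv _; apply: IH.
Qed.

Lemma forces_shrink b E X s j (X' : nat -> Prop) : forces b E X s j -> (forall i, X' i -> X i) -> forces b E X' s j.
Proof. by move=> H sub; apply: forces_persist H _ _ _ _ sub; [split | move=> i; lia]. Qed.

(** If a pair with forced negative literal were accepted, its class would be among those of level
    [2 ^ a], all of which a large reservoir meets. *)
Lemma forces_answers b E X s j : forces b E X s j -> Bl b -> large_below X -> answers (level b) E s j.
Proof.
elim=> {b E X s j} [E X s j H|a E X s k t aO s0 T _ IH|a E X k aO H|e n v E X s m Hv _ IH] Bb HX.
- exact/answers1.
- apply/(answersS _ _ _ aO); left; split=> //; exists t; split=> // j lt.
  by apply: IH => //; apply: Bl_down Bb _; exact: ltO_succ.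
- apply/(answersS _ _ _ aO); right; split=> // A; apply: H.
  have [d [/(in_baseS _ _ aO) Vd Hd]] := meets_of_large_at (cpair 1 (cpair E k)) (HX _ Bb).
  by exists d; split=> //; move: Vd; rewrite /family cfstK csndK => -[[]|[_]] //; exact.
- by rewrite (answers_lim _ _ _ (BlO Bb) Hv); apply: IH => //; exact: (Bl_down Bb (ltO_lim (BlO Bb) Hv)).
Qed.

(** An answer already given by the string needs only a smaller reservoir; the string stays. *)
Lemma force b : inO b -> Bl b -> forall E (X : nat -> Prop) s j, large_below X -> answers (level b) E s j ->
  exists X' : nat -> Prop, [/\ forall i, X' i -> X i, large_below X' & forces b E X' s j].
Proof.
move: b; apply: inO_induction => [|a aO IH|e f lO Hlim IH] Bb E X s j HX.
- by move=> /answers1 H; exists X; split=> //; exact: forces_zero.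
- have Ba : Bl a by apply: Bl_down Bb _; exact: ltO_succ.
  case/(answersS _ _ _ aO) => [[s0 [t [T HR]]]|[-> nA]].
    suff [X' [sub HX' H]] : exists X' : nat -> Prop, [/\ forall i, X' i -> X i, large_below X' &
        forall j, j < csize t -> forces a E X' (cnth t j) j].
      by exists X'; split=> //; exact: forces_pos T H.
    elim: (csize t) HR => [|n IHn] HR; first by exists X.
    have [i lt|Y [sY HY H]] := IHn; first by apply: HR; lia.
    have [X' [sX' HX' H']] := IH Ba E Y _ _ HY (HR n (leqnn _)).
    exists X'; split=> //; first by move=> i /sX' /sY.
    move=> i; rewrite ltnS leq_eqVlt => /orP[/eqP->|lt] //.
    exact: forces_shrink (H i lt) sX'.
  have : ~ LargeS (family (level a) (stage (level a) (cpair E j))) (fun _ => True).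
    by move/LargeP/acceptedE.
  (* Rejection yields a colouring that spoils the stage of [(E, j)]. A large colour class meets all
     previously accepted classes, so it cannot also meet the class of [(E, j)]. *)
  move=> /existsNP[N /existsNP[r /existsNP[chi /not_implyP[bchi bad]]]].
  have [q le HX'] := large_below_color bchi HX.
  exists (fun i => X i /\ chi i = q); split=> //; first by move=> i [].
  apply: (forces_neg aO) => -[d [Ud Hd]]; apply: bad; exists q; split=> // i lt.
  have [[ne Ei]|nEi] := pselect (cfst i <> 0 /\ csnd i = cpair E j).
    exists d; split; first by right; rewrite Ei.
    by apply: hits_mono Hd => k [].
  have [d' [/(in_baseS _ _ aO) Vd' Hd']] := meets_of_large_at i (HX' _ Bb).
  exists d'; split; last by apply: hits_mono Hd' => k [].
  case: Vd' => [V|[ne U]]; [by left | right; split=> //].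
  by case=> [[_ A]|E']; [exact: U | case: nEi].
- rewrite -(cunK j); have [Hn fO lt _] := Hlim (cfst j).
  rewrite (answers_lim _ _ _ lO Hn) => HR.
  have [X' [sX' HX' H]] := IH _ (Bl_down Bb lt) E X s (csnd j) HX HR.
  by exists X'; split=> //; exact: forces_lim Hn H.
Qed.

Lemma force_pos a E X k : Bl a -> large_below X -> accepted (level a) (cpair E k) ->
  exists E' (X' : nat -> Prop), [/\ string_ext E E', newin E E' X, forall i, X' i -> X i, large_below X' & forces (2 ^ a) E' X' 1 k].
Proof.
move=> Ba HX A; have aO := BlO Ba; have Bb := Bl_succ Ba.
have [d [/(in_baseS _ _ aO) Vd Hd]] := meets_of_large_at (cpair 1 (cpair E k)) (HX _ Bb).
move: Vd; rewrite /family cfstK csndK => -[[]|[_ /(_ A)]] //.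
rewrite /in_base_of !(cfstK, csndK) => -[h1 [h2 [h3 h4]]].
have [|X' [sX' HX' H]] := @force _ (O_succ aO) Bb (csnd d) X 1 k HX.
  by apply/(answersS _ _ _ aO); left.
exists (csnd d), X'; split=> // i li; apply: Hd; by rewrite h1.
Qed.

Lemma force_neg a E X k : Bl a -> large_below X -> ~ accepted (level a) (cpair E k) ->
  exists X' : nat -> Prop, [/\ forall i, X' i -> X i, large_below X' & forces (2 ^ a) E X' 0 k].
Proof.
move=> Ba HX A; have aO := BlO Ba; apply: (force (O_succ aO) (Bl_succ Ba)) => //.
by apply/(answersS _ _ _ aO); right.
Qed.

Lemma string_ext_refl E : string_ext E E. Proof. by split. Qed.
Lemma newin_refl E X : newin E E X. Proof. move=> i; lia. Qed.

Lemma string_ext_to E n : exists E', [/\ string_ext E E', n <= csize E' & forall X, newin E E' X].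
Proof.
have [E' [sE nE]] := cseqP (fun i => if i < csize E then cnth E i else 0) (maxn n (csize E)).
exists E'; split; rewrite ?sE ?leq_maxl //.
  by split; rewrite ?sE ?leq_maxr // => i lt; rewrite nE ?lt //; lia.
by move=> X i; rewrite sE => li lt; rewrite nE // ltnNge li.
Qed.

Lemma decide b : inO b -> Bl b -> forall E X j, large_below X ->
  exists E' (X' : nat -> Prop) s, [/\ string_ext E E', newin E E' X, forall i, X' i -> X i, large_below X' &
    s <= 1 /\ forces b E' X' s j].
Proof.
move: b; apply: inO_induction => [|a aO IH|e f lO Hlim IH] Bb E X j HX.
- have [E' [ex le nw]] := string_ext_to E j.+1.
  exists E', X, (cnth E' j != 0); split=> //; split; first by case: (_ != _).
  by apply: forces_zero; split=> //; case: eqP => //; split.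
- have Ba : Bl a by apply: Bl_down Bb _; exact: ltO_succ.
  have [A|nA] := pselect (accepted (level a) (cpair E j)).
    by have [E' [X' [*]]] := force_pos Ba HX A; exists E', X', 1.
  have [X' [*]] := force_neg Ba HX nA; exists E, X', 0; split=> //; exact: newin_refl.
- have [Hn fO lt _] := Hlim (cfst j).
  have [E' [X' [s [h1 h2 h3 h4 [h5 h6]]]]] := IH _ (Bl_down Bb lt) E X (csnd j) HX.
  exists E', X', s; split=> //; split=> //; rewrite -(cunK j); exact: forces_lim Hn h6.
Qed.

(** If no disagreement could be forced, acceptance of [(E, h x)] would decide [Z x]; then [Z] would
    be arithmetical in [Hset (2 ^ b)], hence computable from a level finitely many successors
    higher, still in [Bl]. *)
Lemma force_disagree Z h b E X : computable h -> (forall b, Bl b -> ~ Tred Z (Hset b)) -> Bl b -> large_below X ->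
  exists x E' (X' : nat -> Prop), [/\ string_ext E E', newin E E' X, forall i, X' i -> X i, large_below X' &
    forces (2 ^ b) E' X' (~~ Z x) (h x)].
Proof.
move=> ch hZ Bb HX; apply: contrapT => no.
have bO := BlO Bb.
have HA x : Z x <-> ~ answers (level (2 ^ b)) E 0 (h x).
  rewrite (answersS E 0 (h x) bO); have [A|nA] := pselect (accepted (level b) (cpair E (h x))).
    split=> _; first by case=> -[].
    apply: contrapT => nZ; apply: no; exists x.
    have [E' [X' [h1 h2 h3 h4 h5]]] := force_pos Bb HX A; exists E', X'; split=> //.
    by case: (Z x) nZ.
  split=> [Zx|[]]; last by right.
  case: no; exists x; have [X' [h1 h2 h3]] := force_neg Bb HX nA; exists E, X'; split=> //.
  - exact: newin_refl.
  - by rewrite Zx.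
have bO' := O_succ bO; have HK := arith_level bO'.
have [n T] : arith (Hset (2 ^ b)) (fun x => Z x).
  apply: arith_ext (fun x => iff_sym (HA x)) _.
  by rewrite /answers; apply: arith_not; apply: (arith_sub HK); cfs.
rewrite -Hset_iter // in T; apply: (hZ (iter n (expn 2) (2 ^ b))).
  by elim: n {T} => [|n IH]; [exact: Bl_succ | exact: Bl_succ].
by have -> : Z = (fun x => `[< Z x >]) by apply/funext => x; rewrite asboolb.
Qed.

Lemma string_ext_add E X n : large_below X -> exists E', [/\ string_ext E E', newin E E' X &
  exists i, [/\ n <= i, i < csize E' & cnth E' i <> 0]].
Proof.
(* The new element must lie beyond [n] and beyond the old string; the positions between are filled
   with zeros. *)
move=> HX; have [d [/in_base1[le [i [li [lt ne]]]] Hd]] := meets_of_large_at (maxn n (csize E)) (HX _ Bl1).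
have [E' [sE nE]] := cseqP (fun k => if k < csize E then cnth E k else k == i) i.+1.
exists E'; split; rewrite /string_ext /newin ?sE.
- by split=> [|k lk]; [lia | rewrite nE ?lk //; lia].
- move=> k lk lt'; rewrite nE // ltnNge lk /=; case: eqP => // -> _; exact: Hd.
- exists i; split=> //; first lia.
  by rewrite nE // ltnNge (_ : csize E <= i) ?eqxx //; lia.
Qed.

Definition extends (c' c : nat * (nat -> Prop)) :=
  [/\ string_ext c.1 c'.1, newin c.1 c'.1 c.2 & forall i, c'.2 i -> c.2 i].

Lemma extends_refl c : extends c c.
Proof. by split; [exact: string_ext_refl | exact: newin_refl |]. Qed.

Lemma extends_trans c1 c2 c3 : extends c2 c1 -> extends c3 c2 -> extends c3 c1.
Proof.
move=> [[l1 e1] n1 s1] [[l2 e2] n2 s2]; split; last by move=> i /s2 /s1.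
  by split=> [|i lt]; [lia | rewrite e2 ?e1 //; lia].
move=> i li lt; have [l|l] : i < csize c2.1 \/ csize c2.1 <= i by lia.
  by rewrite e2 //; exact: n1.
by move=> ne; apply: s1; exact: n2.
Qed.

Lemma forces_lec b c c' s j : forces b c.1 c.2 s j -> extends c' c -> forces b c'.1 c'.2 s j.
Proof. by move=> H [h1 h2 h3]; exact: forces_persist H _ _ h1 h2 h3. Qed.

(** * Generic sets from descending sequences of conditions *)

Section Generic.
Variable C : nat -> nat * (nat -> Prop).
Hypothesis C_lec : forall n, extends (C n.+1) (C n).
Hypothesis C_LL : forall n, large_below (C n).2.
Hypothesis C_inf : forall n, exists m i, [/\ n <= i, i < csize (C m).1 & cnth (C m).1 i <> 0].
Hypothesis C_dec : forall b j, Bl b -> exists m s, s <= 1 /\ forces b (C m).1 (C m).2 s j.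

Definition generic_set : set_nat := fun i =>
  `[< exists m, i < csize (C m).1 /\ cnth (C m).1 i <> 0 >].

Lemma C_mono m n : m <= n -> extends (C n) (C m).
Proof.
move=> /subnK <-; elim: (n - m) => [|k IH]; first exact: extends_refl.
exact: extends_trans IH (C_lec _).
Qed.

Lemma generic_set_infinite : infinite_set generic_set.
Proof.
move=> n; have [m [i [le lt ne]]] := C_inf n; exists i => //.
by apply/asboolP; exists m.
Qed.

Lemma generic_setE m i : i < csize (C m).1 -> generic_set i <-> cnth (C m).1 i <> 0.
Proof.
move=> lt; split=> [/asboolP[n [ltn ne]]|ne]; last by apply/asboolP; exists m.
have [le|le] := leqP m n; first by have [[_ <-]] := C_mono le.
by have [[_ ->]] := C_mono (ltnW le).
Qed.

Lemma generic_set_sub (A : nat -> Prop) : (forall i, (C 0).2 i -> A i) -> csize (C 0).1 = 0 -> forall i, generic_set i -> A i.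
Proof.
move=> sub s0 i /asboolP[m [lt ne]]; apply: sub.
have [_ nw _] := C_mono (leq0n m); apply: nw => //; by rewrite s0.
Qed.

(** Rules out [2 ^ 0], which is the notation 1 of zero and not of a successor. *)
Lemma IJ_gt0 X a Y : IJ X a Y -> 0 < a.
Proof. by case=> *; rewrite ?muln_gt0 ?expn_gt0. Qed.

Lemma inO_exp2 a : 0 < a -> inO (2 ^ a) -> inO a.
Proof.
move=> a0; move E: (2 ^ a) => b H; case: H E => [E|c cO E|e f _ _ E].
- by case: (exp2_neq1 a0 E).
- by rewrite (exp2_inj E).
- by case: (exp2_neq_lim E).
Qed.

(** Forced literals are true of every version [Y] of the iterated jump, by induction on its
    construction. *)
Lemma truth b Y : IJ generic_set b Y -> Bl b ->
  forall m s j, forces b (C m).1 (C m).2 s j -> (Y j <-> s <> 0).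
Proof.
elim=> {b Y} [Y EY|a Z Y IJZ IH hjump|e f Zs Y Hset IJZ IH EY] Bb m s j H.
- by have [lt E] := forces_inv1 H; rewrite EY (generic_setE lt) E.
- have aO := inO_exp2 (IJ_gt0 IJZ) (BlO Bb).
  have Ba : Bl a := Bl_down Bb (ltO_succ aO).
  case: (forces_inv2 aO H) => [[s0 [t [[t1 [v Hv]] Ht]]]|[-> no]].
    split=> // _; apply/hjump; exists v; apply: phiC_sound Hv => i lt.
    have := IH Ba _ _ _ (Ht i lt); have := t1 i lt.
    case: (cnth t i) => [|[|n]] // _; case: (Z i) => // -[h1 h2]; [by case: (h1 isT)|by have := h2 (fun e => O_S _ (esym e))].
  (* A halting computation would use a finite segment [t] of [Z]; its literals are all forced at a
     common later stage, whose string then puts the reservoir into the class it avoids. *)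
  split=> // /hjump[v /phiP[t [ag Hv]]]; case: no.
  have [|i lt|n Hn] := @bounded_choice (fun i n => m <= n /\ forces a (C n).1 (C n).2 (Z i) i) (csize t).
  - move=> i n n' le [l1 h]; split; first lia.
    exact: forces_lec h (C_mono le).
  - have [n [sg [sg1 h]]] := C_dec i Ba; exists (maxn m n); split; first exact: leq_maxl.
    have E : sg = Z i.
      have := IH Ba _ _ _ h; move: sg1; case: (sg) => [|[|k]] // _; case: (Z i) => // -[h1 h2]; [by case: (h1 isT)|by have := h2 (fun e => O_S _ (esym e))].
    by rewrite -E; exact: forces_lec h (C_mono (leq_maxr _ _)).
  pose n' := maxn m n; have lmn : m <= n' by exact: leq_maxl.
  have [[l1 e1] nw _] := C_mono lmn.
  exists (cpair (csize (C m).1) (C n').1); split.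
    rewrite /in_base_of !(cfstK, csndK); do 3!split=> //.
    exists t; split.
      by split; [move=> i /ag ->; case: (Z i) | exists v].
    move=> i lt; rewrite (ag i lt).
    apply: (@forces_answers _ _ (C n').2) => //; have [_ h] := Hn i lt.
    exact: forces_lec h (C_mono (leq_maxr _ _)).
  by move=> i; rewrite !(cfstK, csndK); exact: nw.
- rewrite -(cunK j) in H *; rewrite EY.
  apply: IH (forces_inv3 (Hset _) H); exact: (Bl_down Bb (ltO_lim (BlO Bb) (Hset _))).
Qed.

End Generic.

Lemma avoid_below (A : nat -> Prop) (Z : set_nat) : large_below A ->
  (forall b, Bl b -> ~ Tred Z (Hset b)) ->
  exists G : set_nat, [/\ infinite_set G, forall x, G x -> A x & forall b, Bl b -> ~ Tred_jump Z G b].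
Proof.
move=> LA hZ.
have qex (p : prog) : exists h, computable h /\
    forall X (Q : set_nat), (forall x, eval X p x (Q x)) -> forall x, tjump X (h x) = Q x.
  by have [h ch Eh] := jump_query p; exists h.
have [h Hh] := choice qex.
(* [n] codes a level and a number that is read twice, as a literal to decide and as the index of a
   program to defeat. *)
pose D n (c : nat * (nat -> Prop)) := [/\ exists i, [/\ n <= i, i < csize c.1 & cnth c.1 i <> 0],
  Bl (cfst n) -> exists s, s <= 1 /\ forces (cfst n) c.1 c.2 s (csnd n) &
  Bl (cfst n) -> forall p, @unpickle prog (csnd n) = Some p ->
    exists x, forces (2 ^ cfst n) c.1 c.2 (~~ Z x) (h p x)].
have step n c : exists c', large_below c.2 -> [/\ large_below c'.2, extends c' c & D n c'].
  have [HX|] := pselect (large_below c.2); last by exists c.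
  have [E1 [x1 n1 [i [i1 i2 i3]]]] := string_ext_add c.1 n HX.
  have [c2 [l2 H2 D2]] : exists c2, [/\ extends c2 (E1, c.2), large_below c2.2 &
      Bl (cfst n) -> exists s, s <= 1 /\ forces (cfst n) c2.1 c2.2 s (csnd n)].
    have [Bn|nB] := pselect (Bl (cfst n)); last by exists (E1, c.2); split=> //; exact: extends_refl.
    have [E' [X' [s [h1 h2 h3 h4 h5]]]] := decide (BlO Bn) Bn E1 (csnd n) HX.
    by exists (E', X'); split=> // _; exists s.
  have [c3 [l3 H3 D3]] : exists c3, [/\ extends c3 c2, large_below c3.2 &
      Bl (cfst n) -> forall p, @unpickle prog (csnd n) = Some p ->
      exists x, forces (2 ^ cfst n) c3.1 c3.2 (~~ Z x) (h p x)].
    have [Bn|nB] := pselect (Bl (cfst n)); last by exists c2; split=> //; exact: extends_refl.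
    case E: (@unpickle prog (csnd n)) => [p|]; last by exists c2; split=> //; exact: extends_refl.
    have [x [E' [X' [h1 h2 h3 h4 h5]]]] := force_disagree c2.1 (Hh p).1 hZ Bn H2.
    by exists (E', X'); split=> // _ _ [<-]; exists x.
  have l1 : extends (E1, c.2) c by [].
  exists c3 => _; split=> //; first exact: extends_trans (extends_trans l1 l2) l3.
  split=> //; last first.
    by move=> Bn; have [s [s1 Hs]] := D2 Bn; exists s; split=> //; exact: forces_lec Hs l3.
  exists i; have [[a1 a2] _ _] := extends_trans l2 l3; split=> //=.
    exact: leq_trans a1.
  by rewrite a2.
have [F HF] := choice (fun nc : nat * (nat * (nat -> Prop)) => step nc.1 nc.2).
pose C := fix C n := if n is m.+1 then F (m, C m) else (0, A).
have CL n : large_below (C n).2 by elim: n => [|n IH] //=; case: (HF (n, C n) IH).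
have C_lec n : extends (C n.+1) (C n) by case: (HF (n, C n) (CL n)).
have CD n : D n (C n.+1) by case: (HF (n, C n) (CL n)).
have C_dec b j : Bl b -> exists m s, s <= 1 /\ forces b (C m).1 (C m).2 s j.
  by have [_ H _] := CD (cpair b j); rewrite cfstK csndK in H => /H[s Hs]; exists (cpair b j).+1, s.
exists (generic_set C); split.
- apply: generic_set_infinite => n; have [[i Hi] _ _] := CD n; by exists n.+1, i.
- exact: (generic_set_sub C_lec).
- move=> b Bb [Y HY [p Hp]].
  (* If [p] computed [Z] from [Y], the literal [h p x] would have the truth value [Z x], yet the
     opposite was forced. *)
  have [_ _ /(_ _ p)] := CD (cpair b (pickle p)); rewrite cfstK csndK pickleK => /(_ Bb erefl)[x Hx].
  have Ht := truth C_lec CL C_dec (IJ_succ HY (tj_is_jump Y)) (Bl_succ Bb) Hx.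
  by move: Ht; rewrite ((Hh p).2 _ _ Hp); case: (Z x) => -[h1 h2]; [case: (h1 isT) | have := h2 (fun e => O_S _ (esym e))].
Qed.

Lemma large_below_top : large_below (fun _ => True).
Proof. by move=> b Bb; apply: large_at_top; exact: BlO. Qed.

End Forcing.

(** * Closure properties of the notations below the ordinal, and the conclusion *)

Lemma below_props P (hP : notation_system P) alpha (ha : limit_ord P alpha) :
  [/\ below P alpha 1, forall b, below P alpha b -> inO b,
    forall a b, below P alpha b -> ltO a b -> below P alpha a,
    forall a b, below P alpha a -> below P alpha b -> [\/ a = b, ltO a b | ltO b a] &
    forall b, below P alpha b -> below P alpha (2 ^ b)].
Proof.
case: hP => PO Pdown Plin Pfull.
have P1 b : P b -> P 1.
  by move=> Pb; case: (ltO_1 (PO b Pb)) => [<-|] //; exact: Pdown.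
split.
- case: alpha ha => [a [Pa [e E]]|_].
    split; first exact: P1 Pa.
    by case: (ltO_1 (PO a Pa)) => [Ea|//]; case: (@lim_neq1 e); rewrite -E.
  by have [b Pb _] := Pfull 1 O_zero; split=> //; exact: P1 Pb.
- by move=> b [/PO].
- move=> a b [Pb Hb] lt; split; first exact: Pdown lt.
  by case: alpha ha Hb => // c _ Hb; exact: ltO_trans lt Hb.
- by move=> a b [Pa _] [Pb _]; exact: Plin.
- move=> b [Pb Hb]; case: alpha ha Hb => [a [Pa [e E]] Hb|_ _].
    rewrite E in Hb Pa *; have lt := ltO_succ_lim Hb; split=> //; exact: Pdown lt.
  (* Fullness gives a member [c] of the path into which [b + 1] embeds; once [c] lies beyond [b],
     the notation [2 ^ b] is [c] or below it, hence on the path. *)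
  split=> //; have bO := PO b Pb; have [c Pc [g [g1 g2]]] := Pfull _ (O_succ bO).
  suff lt : ltO b c by case: (ltO_succ_le lt) => [->|/(Pdown _ _ Pc)].
  (* Otherwise [g] embeds b + 1 into b, and b, g b, g (g b), ... descends. *)
  suff H : c = b \/ ltO c b -> False by case: (Plin b c Pb Pc) => // [E|lt]; case: H; [left|right].
  move=> le.
  have below_b d : ltO d c -> ltO d b by case: le => [<-|lt] // ltd; exact: ltO_trans ltd lt.
  have gb d : ltO d (2 ^ b) -> ltO (g d) b by move=> /g1 /below_b.
  have desc d : inO d -> ltO d (2 ^ b) -> ltO (g d) d -> False.
    move=> dO; have acc := inO_Acc dO; elim: acc {dO} => {}d _ IH ltd ltg.
    have lt' : ltO (g d) (2 ^ b) by exact: ltO_trans ltg ltd.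
    by apply: (IH _ ltg lt'); exact: g2.
  exact: (desc b bO (ltO_succ bO) (gb b (ltO_succ bO))).
Qed.

Theorem theorem5p24 (P : nat -> Prop) (hP : notation_system P)
    (alpha : option nat) (halpha : limit_ord P alpha) (Z : set_nat)
    (hZ : forall b, below P alpha b -> ~ Tred_jump Z empty_set b)
    (A : set_nat) :
  exists G : set_nat,
    [/\ infinite_set G,
        subset_of G A \/ subset_of G (compl A) &
        forall b, below P alpha b -> ~ Tred_jump Z G b].
Proof.
have [B1 BO Bdown Blin BS] := below_props hP halpha.
have hZ' b : below P alpha b -> ~ Tred Z (Hset b).
  move=> Bb T; apply: (hZ b Bb); exists (Hset b) => //; exact: IJ_Hset (BO b Bb).
have [H|H] := large_below_split Blin (fun i => A i) (large_below_top BO).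
  have [G [Ginf Gsub GZ]] := avoid_below B1 BO Bdown Blin BS H hZ'.
  by exists G; split=> //; left=> x /Gsub[].
have [G [Ginf Gsub GZ]] := avoid_below B1 BO Bdown Blin BS H hZ'.
by exists G; split=> //; right=> x /Gsub[_ /negP].
Qed.
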